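(* Fix $\nu$. Suppose the error assumptions (E1)–(E7) and the regressor condition (R) hold, and $|x_{tj}\epsilon_t^{(\nu')}|\le1$ for all $t$, all $j=1,\dots,p$ and all $\nu'\ge1$. Then $\widehat{\boldsymbol\beta}_{T\nu}\to\boldsymbol\beta_\nu$ in probability as $T,p\to\infty$, provided \[ \log(p)\sqrt p=o\big(\log^{1-a}(T)\big) \] for some $0<a<1$.
   Context: Setting: $p=p_T$ may grow with $T$. Regressors $\mathbf x_t\in\mathbb R^p$, spatial locations $\mathbf s_t\in[0,1]^q$, responses $Y_t^{(\nu)}=\mathbf x_t^\top\boldsymbol\beta_\nu+\epsilon_t^{(\nu)}$, $\nu=1,\dots,d$, $t=1,\dots,T$. $\mathbb P$ is conditional on the regressors. $\mathbb X_T=(\mathbf x_1,\dots,\mathbf x_T)^\top$ full rank, $\widehat{\boldsymbol\beta}_{T\nu}=(\mathbb X_T^\top\mathbb X_T)^{-1}\mathbb X_T^\top(Y_1^{(\nu)},\dots,Y_T^{(\nu)})^\top$. (R): regressors bounded; there exist positive definite $\Sigma_{\mathbf x}$, $\eta\ge0$, $C<\infty$, compact interval $A\subset(0,\infty)$, independent of $T,p$, with $\|T^{-1}\sum_t\mathbf x_t\mathbf x_t^\top-\Sigma_{\mathbf x}\|_2\le Cp^\eta/\sqrt T$ and $\operatorname{spec}(T^{-1}\mathbb X_T^\top\mathbb X_T)\subset A$. Error model: $\boldsymbol\epsilon_t=\mathbf H(\mathbf U_t(\mathbf s_t),\dots,\mathbf U_{t-m}(\mathbf s_t))-\mathbb E\,\mathbf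 H(\mathbf U_t(\mathbf s_t),\dots,\mathbf U_{t-m}(\mathbf s_t))$, $m\in\mathbb N_0$ fixed, $\mathbf H=(H_1,\dots,H_d):\mathbb R^{d\times(m+1)}\to\mathbb R^d$; the $\nu$th coordinate of $\mathbf U_t(\mathbf s)$ is $\sum_{\ell=1}^L\phi_{\nu\ell}d(\mathbf s,\mathbf r_\ell)F_t^{(\ell,\nu)}+E_t^{(\nu)}$ with fixed $L$, real $\phi_{\nu\ell}$, sites $\mathbf r_\ell\in[0,1]^q$, a function $d:[0,1]^q\times[0,1]^q\to[0,1]$, $\mathbf F_t^{(\ell)}=\sum_{j\ge0}\mathbb C_j^{(\ell)}\boldsymbol\varepsilon_{t-j}^{(\ell)}$, $\mathbf E_t=\sum_{j\ge0}\mathbb C_j^{(0)}\boldsymbol\varepsilon_{t-j}^{(0)}$, $d\times d$ matrices $\mathbb C_j^{(\ell)}$ with rows $\mathbf c_j^{(\ell,\nu)\top}$; $\varepsilon_t^{(\ell,\nu)}$ is the $\nu$th coordinate of $\boldsymbol\varepsilon_t^{(\ell)}$. (E1) $\{\boldsymbol\varepsilon_t^{(\ell)}\}_t$, $\ell=0,\dots,L$, mutually independent sequences of independent mean zero vectors $\boldsymbol\varepsilon_t^{(\ell)}=\Sigma_{\varepsilon,t}^{(\ell)1/2}\mathbf u_t^{(\ell)}$, $\Sigma_{\varepsilon,t}^{(\ell)}$ symmetric positive definite, $\mathbf u_t^{(\ell)}$ mean zero with independent coordinates. (E2) $\sup_t\max_\ell\max_\nu\mathbb E|\varepsilon_t^{(\ell,\nu)}|^{2+\delta}<\infty$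 for some $\delta>0$. (E3) If $d=1$: $\sup_t\max_\ell\mathbb E(\varepsilon_t^{(\ell)})^2<\infty$. (E4) If $d=1$: $\mathbb E(\varepsilon_t^{(0)})^2\ge\underline\sigma_0^2>0$; if $d>1$: $\lambda_{\min}(\Sigma_{\varepsilon,t}^{(0)})\ge\underline\lambda>0$. (E5) $\varepsilon_t^{(\ell,\nu)}$ has density $p_t^{(\ell,\nu)}$ with $\sup_t\int|p_t^{(\ell,\nu)}(z+x)-p_t^{(\ell,\nu)}(z)|dz=O(|x|)$. (E6) $\max_\ell\max_\nu\|\mathbf c_j^{(\ell,\nu)}\|_\infty\le C\max(j,1)^{-7/2-\theta}$, some $\theta>0$. (E7) each $H_\nu$ is $L_H$-Lipschitz w.r.t. the Frobenius norm, and some random $d\times(m+1)$ matrix $\Xi$ independent of $\{\mathbf U_t\}$ has $\sup_\nu\mathbb E|H_\nu(\Xi)|^{2+\delta}<\infty$. *)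

(* Defs.v *)
From HB Require Import structures.
From mathcomp Require Import all_boot all_order all_algebra.
From mathcomp Require Import all_classical all_reals all_analysis.
Set Implicit Arguments. Unset Strict Implicit. Unset Printing Implicit Defensive.
Import Order.TTheory GRing.Theory Num.Theory.
Import numFieldNormedType.Exports.
Local Open Scope classical_set_scope.
Local Open Scope ring_scope.

Definition sigma_gen {d} {Omega : measurableType d} {R : realType} {K : Type}
  (X : K -> Omega -> R) : set (set Omega) :=
  <<s \bigcup_(k in [set: K]) preimage_set_system setT (X k) measurable >>.

Definition indep_family {d} {Omega : measurableType d} {R : realType}
  (P : probability Omega R) {I : Type} (G : I -> set (set Omega)) : Prop :=
  forall (n : nat) (f : 'I_n -> I), injective f ->
  forall A : 'I_n -> set Omega, (forall k, G (f k) (A k)) ->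
  P (\bigcap_(k in [set: 'I_n]) A k) = (\prod_(k < n) P (A k))%E.

Definition pos_def {R : realType} {n : nat} (M : 'M[R]_n) : Prop :=
  M^T = M /\ forall v : 'rV[R]_n, v != 0 -> 0 < (v *m M *m v^T) 0 0.

Definition eucl {R : realType} {n : nat} (v : 'cV[R]_n) : R :=
  Num.sqrt (\sum_(i < n) v i 0 ^+ 2).

Definition frob {R : realType} {m n : nat} (A : 'M[R]_(m, n)) : R :=
  Num.sqrt (\sum_(i < m) \sum_(j < n) A i j ^+ 2).

Definition opnorm2 {R : realType} {m n : nat} (M : 'M[R]_(m, n)) : R :=
  sup [set eucl (M *m v) | v in [set v : 'cV[R]_n | eucl v = 1]].

(* linear process  sum_{j>=0} C_j^{(l)} eps_{t-j}^{(l)}, coordinate nu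
   (index l = 0 gives E_t, index l = k+1 gives F_t^{(k+1)}) *)
Definition linproc {Omega : Type} {R : realType} {d L : nat}
  (Cc : 'I_L.+1 -> nat -> 'M[R]_d) (eps : 'I_L.+1 -> int -> 'I_d -> Omega -> R)
  (l : 'I_L.+1) (t : int) (nu : 'I_d) (w : Omega) : R :=
  limn (fun n => \sum_(j < n) \sum_(k < d) Cc l j nu k * eps l (t - (j:nat)%:Z) k w).

Definition Ufield {Omega : Type} {R : realType} {d L q : nat}
  (phi : 'I_d -> 'I_L -> R) (dist : ('I_q -> R) -> ('I_q -> R) -> R)
  (r : 'I_L -> ('I_q -> R))
  (Cc : 'I_L.+1 -> nat -> 'M[R]_d) (eps : 'I_L.+1 -> int -> 'I_d -> Omega -> R)
  (s : 'I_q -> R) (t : int) (nu : 'I_d) (w : Omega) : R :=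
  \sum_(l < L) phi nu l * dist s (r l) * linproc Cc eps (lift ord0 l) t nu w
  + linproc Cc eps ord0 t nu w.

Definition Umat {Omega : Type} {R : realType} {d L q : nat} (m : nat)
  (phi : 'I_d -> 'I_L -> R) (dist : ('I_q -> R) -> ('I_q -> R) -> R)
  (r : 'I_L -> ('I_q -> R))
  (Cc : 'I_L.+1 -> nat -> 'M[R]_d) (eps : 'I_L.+1 -> int -> 'I_d -> Omega -> R)
  (s : 'I_q -> R) (t : int) (w : Omega) : 'M[R]_(d, m.+1) :=
  \matrix_(i < d, k < m.+1) Ufield phi dist r Cc eps s (t - (k:nat)%:Z) i w.

Definition errproc {dO} {Omega : measurableType dO} {R : realType} {d L q : nat}
  (P : probability Omega R) (m : nat)
  (H : 'I_d -> 'M[R]_(d, m.+1) -> R)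
  (phi : 'I_d -> 'I_L -> R) (dist : ('I_q -> R) -> ('I_q -> R) -> R)
  (r : 'I_L -> ('I_q -> R))
  (Cc : 'I_L.+1 -> nat -> 'M[R]_d) (eps : 'I_L.+1 -> int -> 'I_d -> Omega -> R)
  (s : int -> ('I_q -> R)) (t : int) (nu : 'I_d) (w : Omega) : R :=
  H nu (Umat m phi dist r Cc eps (s t) t w)
  - fine ('E_P[fun w' => H nu (Umat m phi dist r Cc eps (s t) t w')]).

Definition errvec {R : realType} {Omega : Type} (e : int -> Omega -> R) (T : nat)
  (w : Omega) : 'cV[R]_T := \col_(i < T) e (i.+1)%:Z w.

Definition ols {R : realType} {T p : nat} (X : 'M[R]_(T, p)) (beta : 'cV[R]_p)
  (e : 'cV[R]_T) : 'cV[R]_p :=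
  invmx (X^T *m X) *m X^T *m (X *m beta + e).

Definition unit_cube {R : realType} (q : nat) :=
  {s : 'I_q -> R | forall i, 0 <= s i <= 1}.

(* Main.v *)
Require Import Defs.
From HB Require Import structures.
From mathcomp Require Import all_boot all_order all_algebra.
From mathcomp Require Import all_classical all_reals all_analysis.
From mathcomp Require Import measurable_realfun ring lra zify.
Import Order.TTheory GRing.Theory Num.Theory.
Import numFieldNormedType.Exports.
Local Open Scope classical_set_scope.
Local Open Scope ring_scope.
Set Implicit Arguments. Unset Strict Implicit. Unset Printing Implicit Defensive.

(** The estimation error is [(X^T X)^-1 X^T e], and the lower bound [lo] on the spectrum
    of [X^T X / T] bounds [lo * |error|] by the norm of [X^T e / T], so it suffices to show
    that the second moment of the latter, a sum over [p] coordinates, tends to zero.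
    Truncating the moving averages after [n] terms changes each [e_t] by [O(1 / (n + 1))]
    in second moment, since the coefficients are dominated by [1 / ((j + 1) (j + 2))] and
    [H] is Lipschitz. The truncated errors are centred, have bounded second moments, and
    are uncorrelated at distance larger than [n + m], because they are functions of
    disjoint blocks of independent innovations. Hence each coordinate of [X^T e / T] has
    second moment [O(1 / (n + 1) + (n + m) / T)]. The rate condition gives
    [p <= (ln T)^2] eventually, so that [p^4 = O(T)], and [n = p^2] makes the total
    [O(1 / p)]; Markov's inequality concludes. *)

(** * Symmetric matrices and the least squares error *)

(** The moving averages have infinite memory in general, so even distant errors may be dependent.
    Truncation takes the place of a mixing estimate: once the memory is finite, distant covariances
    vanish identically, and expanding a square is enough. Summing over coordinates costs a factor
    [p], so both [p / n] and [p n / T] must vanish; with [p^4 = O(T)] the choice [n = p^2] balances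
    them. The weights [1 / ((j + 1) (j + 2))] have tails that telescope exactly. A single random
    variable, the sum of [x_j^2 (j + 1) (j + 2)], then controls every tail and also gives almost
    sure convergence of the moving averages, without which [limn] would say nothing. The truncation
    at [n = 0] has a second use: it replaces the field by the zero matrix, and comparison with it
    yields the second moments of [H] along the process. *)

Lemma row_sqnormE {R : realType} {n : nat} (v : 'rV[R]_n) :
  (v *m v^T) 0 0 = \sum_i v 0 i ^+ 2.
Proof. by rewrite mxE; apply: eq_bigr => i _; rewrite mxE expr2. Qed.

Lemma row_sqnorm_ge0 {R : realType} {n : nat} (v : 'rV[R]_n) : 0 <= (v *m v^T) 0 0.
Proof. by rewrite row_sqnormE; apply: sumr_ge0 => i _; exact: sqr_ge0. Qed.

Lemma row_sqnorm_gt0 {R : realType} {n : nat} (v : 'rV[R]_n) :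
  v != 0 -> 0 < (v *m v^T) 0 0.
Proof.
move=> v0; rewrite lt_neqAle row_sqnorm_ge0 andbT eq_sym; apply: contra v0.
rewrite row_sqnormE psumr_eq0; last by move=> i _; exact: sqr_ge0.
move=> /allP h; apply/eqP/rowP => i; rewrite mxE.
by have := h i (mem_index_enum i); rewrite sqrf_eq0 => /eqP.
Qed.

Lemma quad_form_bound {R : realType} {n : nat} (A : 'M[R]_n) :
  exists2 K, 0 < K & forall v : 'rV[R]_n, `|(v *m A *m v^T) 0 0| <= K * (v *m v^T) 0 0.
Proof.
(* Every product of two entries of [v] is at most the squared norm. The added 1 keeps the constant
   positive even for [A = 0], so that it can be inverted. *)
exists (1 + \sum_j \sum_i `|A i j|).
  by rewrite ltr_pwDl// sumr_ge0// => i _; apply: sumr_ge0.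
move=> v; apply: (@le_trans _ _ ((\sum_j \sum_i `|A i j|) * (v *m v^T) 0 0)); last first.
  by rewrite ler_wpM2r ?row_sqnorm_ge0// lerDr.
rewrite mxE mulr_suml (le_trans (ler_norm_sum _ _ _))//; apply: ler_sum => j _.
rewrite [(v *m A) 0 j]mxE [v^T j 0]mxE mulr_suml (le_trans (ler_norm_sum _ _ _))//.
rewrite big_distrl; apply: ler_sum => i _ /=.
have le1 (k : 'I_n) : v 0 k ^+ 2 <= (v *m v^T) 0 0.
  by rewrite row_sqnormE (bigD1 k)//= lerDl sumr_ge0// => l _; exact: sqr_ge0.
rewrite mulrAC !normrM mulrC; rewrite ler_wpM2l//.
have := le1 i; have := le1 j.
rewrite -(real_normK (num_real (v 0 i))) -(real_normK (num_real (v 0 j))).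
move: (row_sqnorm_ge0 v) (sqr_ge0 (`|v 0 i| - `|v 0 j|)); nra.
Qed.

(* Expand [0 <= w A w^T] at [w = v - c *: v A^-1]. *)
Lemma psd_unit_coercive {R : realType} {n : nat} (A : 'M[R]_n) :
  A^T = A -> A \in unitmx -> (forall v : 'rV[R]_n, 0 <= (v *m A *m v^T) 0 0) ->
  exists2 c, 0 < c & forall v : 'rV[R]_n, c * (v *m v^T) 0 0 <= (v *m A *m v^T) 0 0.
Proof.
move=> symA uA psd; have [K K0 hK] := quad_form_bound (invmx A).
exists K^-1; first by rewrite invr_gt0.
move=> v; set w := v - (K^-1 *: v) *m invmx A.
have symV : (invmx A)^T = invmx A by rewrite trmx_inv symA.
have -> : (v *m A *m v^T) 0 0 = (w *m A *m w^T) 0 0 + 2 * K^-1 * (v *m v^T) 0 0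
    - K^-1 ^+ 2 * (v *m invmx A *m v^T) 0 0.
  have -> : w *m A = v *m A - K^-1 *: v.
    by rewrite mulmxBl -mulmxA mulVmx// mulmx1.
  have -> : w^T = v^T - K^-1 *: (invmx A *m v^T).
    by rewrite /w raddfB/= trmx_mul symV linearZ/= -scalemxAr.
  rewrite mulmxBl !mulmxBr.
  rewrite -!scalemxAl -!scalemxAr scalerA (mulmxA (v *m A)) mulmxK// (mulmxA v).
  set x := v *m A *m v^T; set y := v *m v^T; set z := v *m _ *m _.
  by rewrite !mxE; ring.
have /= := hK v; rewrite ler_norml => /andP[_ h2].
have h1 := psd w.
(* Since [K] bounds the form of [A^-1], the last term uses up only one of the two copies of
   [K^-1 |v|^2] in the expansion; the other copy is the coercivity bound. *)
have : K^-1 ^+ 2 * (v *m invmx A *m v^T) 0 0 <= K^-1 * (v *m v^T) 0 0.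
  have -> : K^-1 * (v *m v^T) 0 0 = K^-1 ^+ 2 * (K * (v *m v^T) 0 0).
    by rewrite expr2 mulrA mulfVK ?gt_eqF.
  by rewrite ler_wpM2l// sqr_ge0.
by move: h1; lra.
Qed.

(* The infimum of the Rayleigh quotient is an eigenvalue: otherwise [G - inf]
   would be positive and invertible, hence coercive. *)
Lemma sym_eigenvalue_ge {R : realType} {n : nat} (G : 'M[R]_n) (lo : R) :
  G^T = G -> (forall a, eigenvalue G a -> lo <= a) ->
  forall v : 'rV[R]_n, lo * (v *m v^T) 0 0 <= (v *m G *m v^T) 0 0.
Proof.
move=> symG hlo v; rewrite leNgt; apply/negP => hv.
have v0 : v != 0 by apply: contraTneq hv => ->; rewrite !mul0mx !mxE mulr0 ltxx.
pose S := [set (w *m G *m w^T) 0 0 / (w *m w^T) 0 0 | w in [set w : 'rV[R]_n | w != 0]].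
have [K K0 hK] := quad_form_bound G.
have hS : has_inf S.
  split; first by exists ((v *m G *m v^T) 0 0 / (v *m v^T) 0 0), v.
  exists (- K) => _ [w /= w0 <-]; rewrite ler_pdivlMr ?row_sqnorm_gt0//.
  by have /= := hK w; rewrite ler_norml mulNr => /andP[].
have infS (w : 'rV[R]_n) : w != 0 -> inf S * (w *m w^T) 0 0 <= (w *m G *m w^T) 0 0.
  move=> w0; rewrite -ler_pdivlMr ?row_sqnorm_gt0//.
  by apply: ge_inf; [exact: hS.2|exists w].
pose A := G - (inf S)%:M.
have qA (w : 'rV[R]_n) : (w *m A *m w^T) 0 0 = (w *m G *m w^T) 0 0 - inf S * (w *m w^T) 0 0.
  by rewrite mulmxBr mulmxBl mul_mx_scalar -scalemxAl !mxE.
have psdA (w : 'rV[R]_n) : 0 <= (w *m A *m w^T) 0 0.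
  have [->|w0] := eqVneq w 0; first by rewrite !mul0mx mxE.
  by rewrite qA subr_ge0 infS.
have symA : A^T = A by rewrite linearB/= tr_scalar_mx symG.
have [uA|nuA] := boolP (A \in unitmx).
  have [c c0 hc] := psd_unit_coercive symA uA psdA.
  have : inf S + c <= inf S.
    apply: lb_le_inf; first exact: hS.1.
    move=> _ [w /= w0 <-]; rewrite ler_pdivlMr ?row_sqnorm_gt0//.
    by have := hc w; rewrite qA; lra.
  by rewrite leNgt ltrDl c0.
(* In the singular case [inf S] is an eigenvalue, hence at least [lo], while the Rayleigh quotient
   of [v] puts it strictly below [lo]. *)
have : eigenvalue G (inf S).
  by rewrite /eigenvalue /eigenspace kermx_eq0 row_free_unit.
move=> /hlo; rewrite leNgt; apply/negP/negPn.
have := infS _ v0 => h; rewrite -(ltr_pM2r (row_sqnorm_gt0 v0)).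
exact: le_lt_trans h hv.
Qed.

Lemma ols_subE {R : realType} {T p : nat} (X : 'M[R]_(T, p)) (b : 'cV[R]_p)
    (e : 'cV[R]_T) : X^T *m X \in unitmx ->
  ols X b e - b = invmx (X^T *m X) *m (X^T *m e).
Proof.
by move=> u; rewrite /ols mulmxDr -!mulmxA (mulmxA X^T X) mulKmx// addrC addKr.
Qed.

(** Let [w] be the error and [g = X^T e / T], so that [G w = g]. The Rayleigh bound gives
    [lo |w|^2 <= w . g], and expanding [|lo w - g|^2 >= 0] gives
    [2 lo (w . g) <= lo^2 |w|^2 + |g|^2]. Together they yield the claim without square roots or a
    norm of the inverse. *)
Lemma ols_error_le {R : realType} {T p : nat} (X : 'M[R]_(T, p)) (b : 'cV[R]_p)
    (e : 'cV[R]_T) (lo : R) : (0 < T)%N -> 0 < lo ->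
  (forall a, eigenvalue (T%:R^-1 *: (X^T *m X)) a -> lo <= a) ->
  lo ^+ 2 * eucl (ols X b e - b) ^+ 2 <= \sum_j (T%:R^-1 * \sum_i X i j * e i 0) ^+ 2.
Proof.
move=> T0 lo0 hlo; set G := T%:R^-1 *: (X^T *m X).
have TR : (T%:R : R) != 0 by rewrite pnatr_eq0 -lt0n.
have symG : G^T = G by rewrite linearZ/= trmx_mul trmxK.
have uG : X^T *m X \in unitmx.
  suff : G \in unitmx.
    by rewrite unitmxZ// unitfE invr_eq0.
  apply: contraT; rewrite -row_free_unit -kermx_eq0 => h.
  suff /hlo : eigenvalue G 0 by rewrite leNgt lo0.
  by rewrite /eigenvalue /eigenspace raddf0 subr0.
rewrite ols_subE// /eucl sqr_sqrtr; last by apply: sumr_ge0 => i _; exact: sqr_ge0.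
set w := invmx _ *m _.
set g := T%:R^-1 *: (X^T *m e).
have Gw : G *m w = g by rewrite /G /w -scalemxAl mulmxA mulmxV// mul1mx.
have -> : \sum_j (T%:R^-1 * \sum_i X i j * e i 0) ^+ 2 = \sum_j g j 0 ^+ 2.
  apply: eq_bigr => j _; rewrite !mxE; congr ((_ * _) ^+ 2).
  by apply: eq_bigr => i _; rewrite mxE.
have /= := sym_eigenvalue_ge symG hlo w^T.
rewrite trmxK -mulmxA Gw !mxE.
under [X in lo * X]eq_bigr do rewrite mxE -expr2.
under [in X in _ <= X -> _]eq_bigr do rewrite mxE.
move=> h.
suff : 2 * lo * \sum_j w j 0 * g j 0 <= lo ^+ 2 * (\sum_j w j 0 ^+ 2) + \sum_j g j 0 ^+ 2.
  have : 2 * lo * (lo * (\sum_j w j 0 ^+ 2)) <= 2 * lo * \sum_j w j 0 * g j 0.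
    by rewrite ler_wpM2l// mulr_ge0// ltW.
  lra.
rewrite !mulr_sumr -big_split/=; apply: ler_sum => j _.
by have := sqr_ge0 (lo * w j 0 - g j 0); lra.
Qed.

(** * Measurability of limits and of Lipschitz images *)

Lemma measurable_set_ler (d : measure_display) (T : measurableType d) (R : realType)
    (f g : T -> R) : measurable_fun setT f -> measurable_fun setT g ->
  measurable [set x | f x <= g x].
Proof.
move=> mf mg; have := measurable_fun_ler mf mg measurableT.
by move=> /(_ [set true] Logic.I); rewrite setTI.
Qed.

Lemma measurable_set_ltr (d : measure_display) (T : measurableType d) (R : realType)
    (f g : T -> R) : measurable_fun setT f -> measurable_fun setT g ->
  measurable [set x | f x < g x].
Proof.
move=> mf mg; have := measurable_fun_ltr mf mg measurableT.
by move=> /(_ [set true] Logic.I); rewrite setTI.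
Qed.

(** The points where the sequence is Cauchy form a measurable set [C], by countable operations. Off
    [C] the value of [limn] is the default point, so the function is the restriction to [C] of a
    genuine pointwise limit. *)
Lemma measurable_fun_limn (d : measure_display) (T : measurableType d) (R : realType)
    (h : nat -> T -> R) :
  (forall n, measurable_fun setT (h n)) ->
  measurable_fun setT (fun x => limn (h ^~ x)).
Proof.
move=> mh.
pose C := \bigcap_k \bigcup_N \bigcap_i
  [set x | `|h (N + i)%N x - h N x| <= k.+1%:R^-1 :> R].
have mC : measurable C.
  apply: bigcapT_measurable => k; apply: bigcupT_measurable => N.
  apply: bigcapT_measurable => i; apply: measurable_set_ler => //.
  by apply: measurableT_comp => //; exact: measurable_funB.
have CP x : C x <-> cvgn (h ^~ x).
  split=> [Cx|/cvg_ex[l hl] k _].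
    apply/cauchy_cvgP/cauchy_exP => e e0.
    have [k ke] : exists k, (k.+1%:R^-1 : R) < e.
      exists (Num.truncn e^-1); rewrite invf_plt ?posrE//.
      by have /andP[] := truncn_itv (ltW (eqbRL (invr_gt0 e) e0)).
    have [N _ hN] := Cx k Logic.I.
    exists (h N x); exists N => // n /= Nn; rewrite /ball/= distrC.
    by rewrite (le_lt_trans _ ke)// -(subnKC Nn); exact: hN.
  move/cvgrPdist_le : hl => /(_ (k.+1%:R^-1 / 2)) [].
    by rewrite divr_gt0// invr_gt0.
  move=> N _ hN; exists N => // i _ /=.
  have h1 := hN _ (leq_addr i N); have h2 := hN N (leqnn N).
  rewrite (le_trans (ler_distD l _ _))// [leRHS]splitr lerD//.
  by rewrite distrC.
have mL : measurable_fun C (fun x => limn (h ^~ x)).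
  apply: (measurable_fun_cvg (h := h)); first by move=> n; exact: measurable_funTS.
  by move=> x /CP.
have -> : (fun x => limn (h ^~ x)) = (fun x => limn (h ^~ x)) \_ C.
  apply/funext => x; rewrite /patch; case: ifPn => // /negP.
  by rewrite inE => nC; apply: dvgP => /CP.
exact: (measurable_restrictT _ mC).1 mL.
Qed.

Lemma measurable_sqrtr (R : realType) : measurable_fun setT (@Num.sqrt R).
Proof. by apply: continuous_measurable_fun => x; exact: sqrt_continuous. Qed.

Lemma frob_ge0 {R : realType} {m n : nat} (A : 'M[R]_(m, n)) : 0 <= frob A.
Proof. exact: sqrtr_ge0. Qed.

Lemma sqr_frob {R : realType} {m n : nat} (A : 'M[R]_(m, n)) :
  frob A ^+ 2 = \sum_(i < m) \sum_(j < n) A i j ^+ 2.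
Proof.
by rewrite sqr_sqrtr// sumr_ge0// => i _; apply: sumr_ge0 => j _; exact: sqr_ge0.
Qed.

Lemma frob_le_entries {R : realType} {m n : nat} (A : 'M[R]_(m, n)) (e : R) : 0 < e ->
  (forall i j, `|A i j| <= e) -> frob A <= e * (m * n)%:R.
Proof.
move=> e0 hA; rewrite -(@ler_pXn2r _ 2) ?nnegrE ?frob_ge0 ?mulr_ge0 ?(ltW e0)//.
rewrite sqr_frob; apply: (@le_trans _ _ (\sum_(i < m) \sum_(j < n) e ^+ 2)).
  apply: ler_sum => i _; apply: ler_sum => j _.
  by rewrite -real_normK ?num_real// ler_pXn2r ?nnegrE ?(ltW e0).
rewrite !(sumr_const, card_ord) -mulrnA -[leLHS]mulr_natr exprMn.
rewrite ler_wpM2l ?sqr_ge0// -natrX ler_nat mulnC -mulnn.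
by case: (m * n)%N => // k; rewrite leq_pmulr.
Qed.

(* [f (Z w) < c] iff [f B + K |Z w - B| < c] for some rational matrix [B]. *)
Lemma measurable_lipschitz_comp (d : measure_display) (T : measurableType d) (R : realType)
    (m n : nat) (f : 'M[R]_(m, n) -> R) (K : R) (Z : 'I_m -> 'I_n -> T -> R) :
  (forall A B, `|f A - f B| <= K * frob (A - B)) ->
  (forall i j, measurable_fun setT (Z i j)) ->
  measurable_fun setT (fun w => f (\matrix_(i, j) Z i j w)).
Proof.
move=> lipf0 mZ.
wlog K0 : K lipf0 / 0 < K.
  move=> /(_ (`|K| + 1)); apply; last by rewrite ltr_wpDl.
  move=> A B; rewrite (le_trans (lipf0 A B))// ler_wpM2r ?frob_ge0//.
  by rewrite (le_trans (ler_norm K))// lerDl.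
pose D (B : 'M[rat]_(m, n)) := map_mx (ratr : rat -> R) B.
pose Zm w : 'M[R]_(m, n) := \matrix_(i, j) Z i j w.
have mfrob B : measurable_fun setT (fun w => frob (Zm w - D B)).
  apply: measurableT_comp; first exact: measurable_sqrtr.
  apply: measurable_sum => i; apply: measurable_sum => j.
  apply: measurable_funX; under eq_fun do rewrite !mxE.
  exact: measurable_funB.
apply: (measurability _ (RGenInftyO.measurableE R)) => _ [_ [c ->] <-]; rewrite setTI.
rewrite (_ : _ @^-1` _ = \bigcup_(B in [set: 'M[rat]_(m, n)])
   [set w | f (D B) + K * frob (Zm w - D B) < c]); last first.
  apply/seteqP; split => w /=; last first.
    move=> [B _ /=]; rewrite in_itv/=; apply: le_lt_trans.
    by have := lipf0 (Zm w) (D B); rewrite ler_norml => /andP[_]; rewrite lerBlDl.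
  rewrite in_itv/= -/(Zm w) => fc.
  (* The gap [c - f (Zm w)] has to pay [K * frob] twice: once for moving [f] to the rational matrix,
     once for the term added in the union. The successor in [(m * n).+1] makes the inequality strict
     and the divisor nonzero for empty matrices. *)
  pose g := (c - f (Zm w)) / (2 * K * (m * n).+1%:R).
  have g0 : 0 < g by rewrite divr_gt0 ?subr_gt0// !mulr_gt0.
  have hq0 i j : {q : rat | `|Zm w i j - ratr q| <= g}.
    apply/cid.
    have : Zm w i j - g < Zm w i j by rewrite ltrBlDr ltrDl.
    move=> /rat_in_itvoo[q]; rewrite in_itv/= => /andP[q1 q2]; exists q.
    rewrite ger0_norm; lra.
  have [q hq] : exists q : 'I_m -> 'I_n -> rat, forall i j, `|Zm w i j - ratr (q i j)| <= g.
    by exists (fun i j => sval (hq0 i j)) => i j; exact: svalP (hq0 i j).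
  pose B : 'M[rat]_(m, n) := \matrix_(i, j) q i j.
  exists B => //=.
  have hB : frob (Zm w - D B) <= g * (m * n)%:R.
    by apply: frob_le_entries => // i j; have := hq i j; rewrite /D /B !mxE.
  have hg : g * (2 * K * (m * n).+1%:R) = c - f (Zm w).
    by rewrite /g divfK// gt_eqF// !mulr_gt0.
  have h1 : 2 * K * frob (Zm w - D B) < c - f (Zm w).
    rewrite -hg.
    apply: (@le_lt_trans _ _ (2 * K * (g * (m * n)%:R))).
      by rewrite ler_wpM2l// mulr_ge0// ltW.
    rewrite -subr_gt0 -natr1.
    have : 0 < g * K by rewrite mulr_gt0.
    lra.
  have := lipf0 (Zm w) (D B); rewrite ler_norml => /andP[h2 _].
  lra.
rewrite (_ : \bigcup_(B in _) _ = \bigcup_k (if unpickle k is Some B then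
    [set w | f (D B) + K * frob (Zm w - D B) < c] else set0)); last first.
  apply/seteqP; split => w /=; first by case=> B _ ?; exists (pickle B); rewrite ?pickleK.
  by case=> k _; case: unpickle => // B ?; exists B.
apply: bigcupT_measurable => k; case: unpickle => // B; apply: measurable_set_ltr => //.
by apply: measurable_funD => //; exact: measurable_funM.
Qed.

(** * Second moments *)

(** Valued in the extended reals, so that a bound by some [K%:E] also expresses finiteness;
    integrability is later deduced from such bounds alone. *)
Definition second_moment {d : measure_display} {T : measurableType d} {R : realType}
  (P : probability T R) (f : T -> R) : \bar R := (\int[P]_w (f w ^+ 2)%:E)%E.

Lemma second_moment_ge0 {d : measure_display} {T : measurableType d} {R : realType}
  (P : probability T R) (f : T -> R) : (0 <= second_moment P f)%E.
Proof. by apply: integral_ge0 => w _; rewrite lee_fin sqr_ge0. Qed.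

Lemma measurable_sqr_EFin {d : measure_display} {T : measurableType d} {R : realType}
  (f : T -> R) : measurable_fun setT f -> measurable_fun setT (fun w => (f w ^+ 2)%:E).
Proof. by move=> mf; apply/measurable_EFinP; exact: measurable_funX. Qed.

Lemma le_second_moment {d : measure_display} {T : measurableType d} {R : realType}
    (P : probability T R) (f g : T -> R) :
  measurable_fun setT f -> measurable_fun setT g ->
  (forall w, `|f w| <= `|g w|) -> (second_moment P f <= second_moment P g)%E.
Proof.
move=> mf mg fg; apply: ge0_le_integral => //.
- by move=> w _; rewrite lee_fin sqr_ge0.
- exact: measurable_sqr_EFin.
- exact: measurable_sqr_EFin.
- by move=> w _; rewrite lee_fin -real_normK ?num_real// -(real_normK (num_real (g w)))
    ler_pXn2r ?nnegrE.
Qed.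

Lemma second_momentZ {d : measure_display} {T : measurableType d} {R : realType}
    (P : probability T R) (f : T -> R) (c : R) : measurable_fun setT f ->
  second_moment P (fun w => c * f w) = ((c ^+ 2)%:E * second_moment P f)%E.
Proof.
move=> mf; rewrite /second_moment; under eq_integral do rewrite exprMn EFinM.
rewrite ge0_integralZl_EFin ?sqr_ge0//; first by move=> w _; rewrite lee_fin sqr_ge0.
exact: measurable_sqr_EFin.
Qed.

(** Cauchy-Schwarz as nonnegativity of an empirical variance: the deviations [n x_i - X] have sum of
    squares [n (n Q - X^2)]. *)
Lemma sqr_sum_le {R : realType} (n : nat) (x : 'I_n -> R) :
  (\sum_i x i) ^+ 2 <= n%:R * \sum_i x i ^+ 2.
Proof.
case: n x => [|n] x; first by rewrite !big_ord0 expr0n mul0r.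
set X := \sum_i x i; set Q := \sum_i _.
have : 0 <= \sum_(i < n.+1) (n.+1%:R * x i - X) ^+ 2.
  by apply: sumr_ge0 => i _; exact: sqr_ge0.
have -> : \sum_(i < n.+1) (n.+1%:R * x i - X) ^+ 2 = n.+1%:R * (n.+1%:R * Q - X ^+ 2).
  under eq_bigr => i _.
    have -> : (n.+1%:R * x i - X) ^+ 2 =
      n.+1%:R ^+ 2 * x i ^+ 2 + (- (2 * n.+1%:R * X) * x i + X ^+ 2) by ring.
    over.
  rewrite !big_split/= sumr_const card_ord -!mulr_sumr -/X -/Q -(mulr_natr (X ^+ 2)); ring.
by rewrite pmulr_rge0 ?ltr0n// subr_ge0.
Qed.

Lemma second_moment_sum_le {d : measure_display} {T : measurableType d} {R : realType}
    (P : probability T R) (n : nat) (f : 'I_n -> T -> R) (K : R) :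
  (forall i, measurable_fun setT (f i)) -> (forall i, second_moment P (f i) <= K%:E)%E ->
  (second_moment P (fun w => \sum_i f i w)%R <= (n%:R ^+ 2 * K)%:E)%E.
Proof.
move=> mf fK.
apply: (@le_trans _ _ (\int[P]_w (n%:R%:E * \sum_(i < n) (f i w ^+ 2)%:E))%E).
  apply: ge0_le_integral => //.
  - by move=> w _; rewrite lee_fin sqr_ge0.
  - by apply: measurable_sqr_EFin; exact: measurable_sum.
  - apply: measurable_funeM; apply: emeasurable_sum => i; exact: measurable_sqr_EFin.
  - by move=> w _; rewrite sumEFin -EFinM lee_fin sqr_sum_le.
rewrite ge0_integralZl_EFin//; last 2 first.
  - by move=> w _; apply: sume_ge0 => i _; rewrite lee_fin sqr_ge0.
  - by apply: emeasurable_sum => i; exact: measurable_sqr_EFin.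
rewrite ge0_integral_sum//; last 2 first.
  - by move=> i; exact: measurable_sqr_EFin.
  - by move=> i w _; rewrite lee_fin sqr_ge0.
rewrite expr2 -mulrA EFinM lee_wpmul2l ?lee_fin//.
apply: (@le_trans _ _ (\sum_(i < n) K%:E)%E); first by apply: lee_sum => i _; exact: fK.
by rewrite sumEFin lee_fin sumr_const card_ord mulr_natl.
Qed.

Lemma second_moment_add_le {d : measure_display} {T : measurableType d} {R : realType}
    (P : probability T R) (f g : T -> R) (K L : R) :
  measurable_fun setT f -> measurable_fun setT g ->
  (second_moment P f <= K%:E)%E -> (second_moment P g <= L%:E)%E ->
  (second_moment P (fun w => f w + g w)%R <= (2 * (K + L))%:E)%E.
Proof.
move=> mf mg fK gL.
apply: (@le_trans _ _ (\int[P]_w (2%:E * ((f w ^+ 2)%:E + (g w ^+ 2)%:E)))%E).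
  apply: ge0_le_integral => //.
  - by move=> w _; rewrite lee_fin sqr_ge0.
  - by apply: measurable_sqr_EFin; exact: measurable_funD.
  - apply: measurable_funeM; apply: emeasurable_funD; exact: measurable_sqr_EFin.
  - move=> w _; rewrite -EFinD -EFinM lee_fin.
    by have := sqr_ge0 (f w - g w); lra.
rewrite ge0_integralZl_EFin//; last 2 first.
  - by move=> w _; rewrite -EFinD lee_fin addr_ge0// sqr_ge0.
  - by apply: emeasurable_funD; exact: measurable_sqr_EFin.
rewrite ge0_integralD//; last 4 first.
  - by move=> w _; rewrite lee_fin sqr_ge0.
  - exact: measurable_sqr_EFin.
  - by move=> w _; rewrite lee_fin sqr_ge0.
  - exact: measurable_sqr_EFin.
by rewrite EFinM lee_wpmul2l ?lee_fin// EFinD leeD.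
Qed.

Lemma telescope_inv_mul_succ {R : realType} (n N : nat) : (n <= N)%N ->
  \sum_(n <= j < N) ((j.+1 * j.+2)%:R^-1 : R) = n.+1%:R^-1 - N.+1%:R^-1.
Proof.
move=> nN; have := telescope_sumr (fun j => - (j.+1%:R^-1 : R)) nN.
rewrite opprK addrC => <-.
apply: eq_big_nat => j _.
have h2 : (j.+2%:R : R) = j.+1%:R + 1 by rewrite natr1.
have h1 : (j.+1%:R : R) != 0 by rewrite pnatr_eq0.
have h3 : (j.+1%:R + 1 : R) != 0 by rewrite natr1 pnatr_eq0.
rewrite natrM h2; move: (j.+1%:R : R) h1 h3 => a a0 a1.
by field; rewrite a0 a1.
Qed.

(* Weighted Cauchy-Schwarz; the weights [1 / ((j+1)(j+2))], [j >= n], sum to [1 / (n+1)]. *)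
Lemma sqr_block_sum_le {R : realType} (x : nat -> R) (n N : nat) :
  n.+1%:R * (\sum_(n <= j < N) x j) ^+ 2
    <= \sum_(n <= j < N) x j ^+ 2 * (j.+1 * j.+2)%:R.
Proof.
have [Nn|/ltnW nN] := leqP N n; first by rewrite !big_geq// expr0n mulr0.
set X := \sum_(n <= j < N) x j; set Q := \sum_(n <= j < N) _.
(* Equality in Cauchy-Schwarz requires [x j * (j+1)(j+2)] to be constant; [l] is that constant when
   the weights have their full sum [1 / (n+1)]. For a finite [N] their sum is smaller, which only
   helps. *)
pose l := n.+1%:R * X.
have : 0 <= \sum_(n <= j < N) (x j * (j.+1 * j.+2)%:R - l) ^+ 2 * (j.+1 * j.+2)%:R^-1.
  by apply: sumr_ge0 => j _; rewrite mulr_ge0 ?sqr_ge0// invr_ge0.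
have -> : \sum_(n <= j < N) (x j * (j.+1 * j.+2)%:R - l) ^+ 2 * (j.+1 * j.+2)%:R^-1
   = Q - 2 * l * X + l ^+ 2 * (n.+1%:R^-1 - N.+1%:R^-1).
  rewrite -telescope_inv_mul_succ// /Q /X !mulr_sumr -sumrB -big_split/=.
  apply: eq_big_nat => j _; have : ((j.+1 * j.+2)%:R : R) != 0.
    by rewrite pnatr_eq0 muln_eq0.
  move: ((j.+1 * j.+2)%:R : R) => c c0.
  by field.
have : l ^+ 2 * (n.+1%:R^-1 - N.+1%:R^-1) <= n.+1%:R * X ^+ 2.
  have -> : n.+1%:R * X ^+ 2 = l ^+ 2 * n.+1%:R^-1.
    have : (n.+1%:R : R) != 0 by rewrite pnatr_eq0.
    by rewrite /l; move: (n.+1%:R : R) => c c0; field.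
  by rewrite ler_wpM2l ?sqr_ge0// lerBlDr lerDl invr_ge0.
move: (l ^+ 2 * _) => z; rewrite /l; move: (n.+1%:R : R) => c; lra.
Qed.

(** The variable [S], the sum of [x_j^2 (j+1)(j+2)], has mean at most [M] and is therefore almost
    surely finite. Where it is finite, every block of terms starting at [k] has square at most
    [S / (k+1)]: this makes the partial sums Cauchy, so that [limn] is a true limit, and letting the
    end of the block go to infinity bounds the squared tail by [S / (n+1)]. *)
Lemma second_moment_series_tail {d : measure_display} {T : measurableType d}
    {R : realType} (P : probability T R) (x : nat -> T -> R) (M : R) :
  (forall j, measurable_fun setT (x j)) ->
  (forall j, second_moment P (x j) <= (M * (j.+1 * j.+2)%:R^-1 ^+ 2)%:E)%E ->
  forall n, (second_moment P (fun w => limn (fun N => \sum_(j < N) x j w)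
    - \sum_(j < n) x j w)%R <= (M / n.+1%:R)%:E)%E.
Proof.
move=> mx hx n.
pose g (j : nat) w : \bar R := (x j w ^+ 2 * (j.+1 * j.+2)%:R)%:E.
have mg j : measurable_fun setT (g j).
  by apply/measurable_EFinP; apply: measurable_funM => //; exact: measurable_funX.
have g0 j w : (0 <= g j w)%E by rewrite lee_fin mulr_ge0// sqr_ge0.
pose S w : \bar R := (\sum_(j <oo) g j w)%E.
have mS : measurable_fun setT S.
  by apply: ge0_emeasurable_sum.
have S0 w : (0 <= S w)%E by apply: nneseries_ge0.
have M0 : 0 <= M.
  have := le_trans (second_moment_ge0 P (x 0%N)) (hx 0%N).
  by rewrite lee_fin pmulr_lge0// exprn_gt0// invr_gt0.
have intS : (\int[P]_w S w <= M%:E)%E.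
  rewrite integral_nneseries//.
  have h j : (\int[P]_w g j w <= (M * (j.+1 * j.+2)%:R^-1)%:E)%E.
    under eq_integral do rewrite /g mulrC EFinM.
    rewrite ge0_integralZl_EFin//; last 2 first.
      by move=> w _; rewrite lee_fin sqr_ge0.
      exact: measurable_sqr_EFin.
    apply: (le_trans (lee_wpmul2l _ (hx j))); first by rewrite lee_fin.
    have : ((j.+1 * j.+2)%:R : R) != 0 by rewrite pnatr_eq0 muln_eq0.
    move: ((j.+1 * j.+2)%:R : R) => c c0.
    rewrite -EFinM lee_fin (_ : c * (M * c^-1 ^+ 2) = M * c^-1)//.
    by field.
  apply: lime_le; first by apply: is_cvg_nneseries => j _ _; apply: integral_ge0.
  apply: nearW => N; apply: (le_trans (lee_sum _ (fun j _ => h j))).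
  rewrite sumEFin lee_fin -mulr_sumr telescope_inv_mul_succ// invr1.
  by rewrite ler_piMr// gerBl invr_ge0.
have finS : {ae P, forall w, setT w -> S w \is a fin_num}.
  apply: integrable_ae => //; apply/integrableP; split => //.
  under eq_integral do rewrite gee0_abs//.
  by rewrite (le_lt_trans intS)// ltry.
have block w : S w \is a fin_num -> forall k N,
    k.+1%:R * (\sum_(k <= j < N) x j w) ^+ 2 <= fine (S w).
  move=> fS k N; apply: (le_trans (sqr_block_sum_le _ _ _)).
  rewrite -lee_fin fineK//.
  apply: (@le_trans _ _ (\sum_(0 <= j < N) g j w)%E); last exact: nneseries_lim_ge.
  have [kN|/ltnW Nk] := leqP k N; last first.
    by rewrite [X in X%:E](big_geq Nk); apply: sume_ge0.
  rewrite [leRHS](big_cat_nat (n := k))//= -[leLHS]sumEFin leeDr//.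
  by apply: sume_ge0 => j _; exact: g0.
have cvgS w : S w \is a fin_num -> cvgn (fun N => \sum_(j < N) x j w).
  move=> /block hb; apply/cauchy_cvgP/cauchy_exP => e e0.
  (* With this choice [k + 1] exceeds [S / e^2], so the block bound [S / (k+1)] is below [e^2]. *)
  pose k := Num.truncn (fine (S w) / e ^+ 2).
  exists (\sum_(j < k) x j w); exists k => // N /= kN; rewrite /ball/= distrC.
  rewrite -!(big_mkord xpredT (fun j => x j w)) (big_cat_nat (n := k))//= addrAC subrr add0r.
  rewrite -(@ltr_pXn2r _ 2) ?nnegrE ?(ltW e0)// real_normK ?num_real//.
  have := hb k N; rewrite mulrC -ler_pdivlMr ?ltr0n// => /le_lt_trans; apply.
  rewrite ltr_pdivrMr ?ltr0n// mulrC -ltr_pdivrMr ?exprn_gt0//.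
  have h0 : 0 <= fine (S w) / e ^+ 2 by rewrite divr_ge0 ?fine_ge0 ?sqr_ge0.
  by have /andP[] := truncn_itv h0.
have mlim : measurable_fun setT (fun w => limn (fun N => \sum_(j < N) x j w)
    - \sum_(j < n) x j w).
  apply: measurable_funB; last exact: measurable_sum.
  by apply: measurable_fun_limn => N; exact: measurable_sum.
apply: (@le_trans _ _ (\int[P]_w (n.+1%:R^-1%:E * S w))%E); last first.
  rewrite ge0_integralZl_EFin// mulrC EFinM lee_wpmul2l// lee_fin.
apply: ae_ge0_le_integral => //.
- by move=> w _; rewrite lee_fin sqr_ge0.
- exact: measurable_sqr_EFin.
- by move=> w _; rewrite mule_ge0.
- exact: measurable_funeM.
apply: filterS finS => w /(_ Logic.I) fS _.
rewrite -(fineK fS) -EFinM lee_fin mulrC ler_pdivlMr ?ltr0n// mulrC.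
have cl := cvgS _ fS.
have : (fun N => n.+1%:R * (\sum_(j < N) x j w - \sum_(j < n) x j w) ^+ 2) @ \oo -->
   n.+1%:R * (limn (fun N => \sum_(j < N) x j w) - \sum_(j < n) x j w) ^+ 2.
  apply: cvgM; first exact: cvg_cst.
  rewrite expr2; under eq_fun do rewrite expr2.
  by apply: cvgM; (apply: cvgB; [exact: cl|exact: cvg_cst]).
move=> cl2; rewrite -(cvg_lim _ cl2)//; apply: limr_le; first by apply/cvg_ex; eexists; exact: cl2.
exists n => // N /= nN.
rewrite -!(big_mkord xpredT (fun j => x j w)) (big_cat_nat (n := n) (p := N))//=.
by rewrite addrAC subrr add0r; exact: block.
Qed.

Lemma second_moment_cst {d : measure_display} {T : measurableType d} {R : realType}
  (P : probability T R) (c : R) : second_moment P (fun=> c) = (c ^+ 2)%:E.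
Proof. by rewrite /second_moment integral_cst//= probability_setT mule1. Qed.

Lemma integrable_sqr {d : measure_display} {T : measurableType d} {R : realType}
    (P : probability T R) (f : T -> R) (K : R) :
  measurable_fun setT f -> (second_moment P f <= K%:E)%E ->
  P.-integrable setT (fun w => (f w ^+ 2)%:E).
Proof.
move=> mf fK; apply/integrableP; split; first exact: measurable_sqr_EFin.
under eq_integral do rewrite gee0_abs ?lee_fin ?sqr_ge0//.
by rewrite (le_lt_trans fK)// ltry.
Qed.

Lemma integrable_mul {d : measure_display} {T : measurableType d} {R : realType}
    (P : probability T R) (f g : T -> R) (K L : R) :
  measurable_fun setT f -> measurable_fun setT g ->
  (second_moment P f <= K%:E)%E -> (second_moment P g <= L%:E)%E ->
  P.-integrable setT (fun w => (f w * g w)%:E).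
Proof.
move=> mf mg fK gL.
apply: (le_integrable measurableT (g := fun w => (f w ^+ 2)%:E + (g w ^+ 2)%:E)%E).
- by apply/measurable_EFinP; exact: measurable_funM.
- move=> w _; rewrite -EFinD !abse_EFin lee_fin [leRHS]ger0_norm ?addr_ge0 ?sqr_ge0//.
  rewrite normrM -(real_normK (num_real (f w))) -(real_normK (num_real (g w))).
  by have := sqr_ge0 (`|f w| - `|g w|); have := sqr_ge0 (`|f w| + `|g w|); lra.
- by apply: integrableD => //; [exact: (integrable_sqr mf fK)|exact: (integrable_sqr mg gL)].
Qed.

Lemma integrable_second_moment {d : measure_display} {T : measurableType d} {R : realType}
    (P : probability T R) (f : T -> R) (K : R) :
  measurable_fun setT f -> (second_moment P f <= K%:E)%E ->
  P.-integrable setT (EFin \o f).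
Proof.
move=> mf fK.
have := @integrable_mul _ _ _ P f (cst 1) K 1 mf (@measurable_cst _ _ _ _ _ _) fK.
under eq_fun do rewrite mulr1; apply.
by rewrite second_moment_cst expr1n.
Qed.

(** [E f^2 = E (f - c)^2 + c^2] for the mean [c]. The bound [K] makes [f] integrable, so [fine]
    returns the actual mean and not a default value. *)
Lemma second_moment_center_le {d : measure_display} {T : measurableType d} {R : realType}
    (P : probability T R) (f : T -> R) (K : R) :
  measurable_fun setT f -> (second_moment P f <= K%:E)%E ->
  (second_moment P (fun w => f w - fine 'E_P[f])%R <= second_moment P f)%E.
Proof.
move=> mf fK; set c := fine _.
have intf := integrable_second_moment mf fK.
have cE : (\int[P]_w (f w)%:E = c%:E)%E.
  by rewrite /c unlock fineK//; exact: integrable_fin_num.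
have mfc : measurable_fun setT (fun w => f w - c) by exact: measurable_funB.
have intc (x : R) : P.-integrable setT (fun=> x%:E).
  exact: (finite_measure_integrable_cst P x measurableT).
have ifc : (second_moment P (fun w => f w - c)%R <= (2 * (K + c ^+ 2))%:E)%E.
  apply: second_moment_add_le => //.
  by rewrite second_moment_cst sqrrN.
have -> : second_moment P f = (second_moment P (fun w => f w - c)%R
    + \int[P]_w ((2 * c)%:E * (f w)%:E + (- c ^+ 2)%:E))%E.
  rewrite -integralD//; last 2 first.
    exact: (integrable_sqr mfc ifc).
    by apply: integrableD => //; exact: integrableZl.
  apply: eq_integral => w _; rewrite -EFinM -!EFinD; congr EFin; ring.
rewrite integralD//; last by apply: integrableZl.
rewrite integralZl// cE integral_cst//= probability_setT mule1 -EFinM -EFinD.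
rewrite leeDl// lee_fin; have := sqr_ge0 c; lra.
Qed.

Lemma integral_center0 {d : measure_display} {T : measurableType d} {R : realType}
    (P : probability T R) (f : T -> R) (K : R) :
  measurable_fun setT f -> (second_moment P f <= K%:E)%E ->
  (\int[P]_w (f w - fine 'E_P[f])%:E = 0)%E.
Proof.
move=> mf fK; set c := fine _.
have intf := integrable_second_moment mf fK.
have cE : (\int[P]_w (f w)%:E = c%:E)%E.
  by rewrite /c unlock fineK//; exact: integrable_fin_num.
under eq_integral do rewrite EFinB.
rewrite integralB//; last exact: (finite_measure_integrable_cst P c measurableT).
by rewrite cE integral_cst//= probability_setT mule1 subee.
Qed.

Lemma card_band_le (N k : nat) (i : 'I_N) :
  (#|[set j : 'I_N | (i <= j + k)%N && (j <= i + k)%N]%SET| <= (2 * k).+1)%N.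
Proof.
(* The subtraction [i - k] is truncated: for [i < k] the window starts at 0, and its length [2k + 1]
   still reaches [i + k]. *)
rewrite cardE -(size_map val) -(size_iota (i - k) (2 * k).+1).
apply: uniq_leq_size; first by rewrite map_inj_uniq ?enum_uniq//; exact: val_inj.
move=> _ /mapP[j + ->]; rewrite mem_enum inE mem_iota => /andP[h1 h2].
by move: h1 h2; rewrite /=; lia.
Qed.

(** In the expanded square only pairs at distance at most [k] survive. Each contributes at most
    [B^2 K], as [|f g| <= (f^2 + g^2) / 2], and a row of the band has at most [2k + 1] of them: the
    growth is linear in [N] instead of quadratic. *)
Lemma second_moment_banded_sum_le {d : measure_display} {T : measurableType d}
    {R : realType} (P : probability T R) (N k : nat) (x : 'I_N -> R)
    (f : 'I_N -> T -> R) (B K : R) :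
  (forall i, measurable_fun setT (f i)) -> (forall i, second_moment P (f i) <= K%:E)%E ->
  (forall i, `|x i| <= B) ->
  (forall i j : 'I_N, (i + k < j)%N -> (\int[P]_w (f i w * f j w)%:E = 0)%E) ->
  (second_moment P (fun w => \sum_i x i * f i w)%R
    <= (B ^+ 2 * K * (N * (2 * k).+1)%:R)%:E)%E.
Proof.
move=> mf fK xB cov0.
(* The empty sum is set apart because the signs of [K] and [B] are read off from an actual index. *)
have [N0|N0] := posnP N.
  subst N; rewrite /second_moment; under eq_integral do rewrite big_ord0 expr0n.
  by rewrite integral0 mul0n mulr0.
pose i0 := Ordinal N0.
have K0 : 0 <= K by have := le_trans (second_moment_ge0 P (f i0)) (fK i0); rewrite lee_fin.
have B0 : 0 <= B := le_trans (normr_ge0 _) (xB i0).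
have intff i j : P.-integrable setT (fun w => (f i w * f j w)%:E).
  exact: (integrable_mul (mf i) (mf j) (fK i) (fK j)).
have covK i j : (`|\int[P]_w (f i w * f j w)%:E| <= K%:E)%E.
  apply: (le_trans (le_abse_integral P measurableT (measurable_int _ (intff i j)))).
  apply: (@le_trans _ _ (\int[P]_w (2^-1%:E * ((f i w ^+ 2)%:E + (f j w ^+ 2)%:E)))%E).
    apply: ge0_le_integral => //.
    - by apply: measurableT_comp => //; exact: (measurable_int _ (intff i j)).
    - by apply: measurable_funeM; apply: emeasurable_funD; exact: measurable_sqr_EFin.
    - move=> w _; rewrite -EFinD -EFinM abse_EFin lee_fin normrM.
      rewrite -(real_normK (num_real (f i w))) -(real_normK (num_real (f j w))).
      by have := sqr_ge0 (`|f i w| - `|f j w|); lra.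
  rewrite ge0_integralZl_EFin//; last 2 first.
  - by move=> w _; rewrite -EFinD lee_fin addr_ge0// sqr_ge0.
  - by apply: emeasurable_funD; exact: measurable_sqr_EFin.
  rewrite ge0_integralD//; last 4 first.
  - by move=> w _; rewrite lee_fin sqr_ge0.
  - exact: measurable_sqr_EFin.
  - by move=> w _; rewrite lee_fin sqr_ge0.
  - exact: measurable_sqr_EFin.
  apply: (@le_trans _ _ (2^-1%:E * (K%:E + K%:E))%E).
    by rewrite lee_wpmul2l ?lee_fin// leeD// fK.
  by rewrite -EFinD -EFinM lee_fin; lra.
have -> : second_moment P (fun w => \sum_i x i * f i w) =
    (\sum_(i < N) \sum_(j < N) (x i * x j)%:E * \int[P]_w (f i w * f j w)%:E)%E.
  rewrite /second_moment.
  transitivity (\int[P]_w (\sum_(i < N) \sum_(j < N) (x i * x j)%:E * (f i w * f j w)%:E))%E.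
    apply: eq_integral => w _; rewrite expr2 mulr_suml -sumEFin; apply: eq_bigr => i _.
    rewrite mulr_sumr -sumEFin; apply: eq_bigr => j _.
    by rewrite -EFinM mulrACA.
  rewrite integral_sum//; last first.
    by move=> i; apply: integrable_sum => // j _; exact: integrableZl.
  apply: eq_bigr => i _; rewrite integral_sum//; last by move=> j; exact: integrableZl.
  by apply: eq_bigr => j _; rewrite integralZl.
apply: (@le_trans _ _ (\sum_(i < N) \sum_(j < N)
    (if ((i <= j + k)%N && (j <= i + k)%N) then B ^+ 2 * K else 0)%:E)%E).
  apply: lee_sum => i _; apply: lee_sum => j _; case: ifPn => [_|h].
    apply: (le_trans (lee_abs _)); rewrite abseM (EFinM (B ^+ 2)); apply: lee_pmul => //.
    by rewrite abse_EFin lee_fin normrM expr2 ler_pM.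
  have -> : (\int[P]_w (f i w * f j w)%:E = 0)%E; last by rewrite mule0.
  move: h; rewrite negb_and -!ltnNge => /orP[h|h]; last exact: cov0.
  by under eq_integral do rewrite mulrC; exact: cov0.
under eq_bigr do rewrite sumEFin.
rewrite sumEFin lee_fin natrM mulrCA mulr_natl -[in leRHS](card_ord N) -sumr_const.
apply: ler_sum => i _; rewrite -big_mkcond sumr_const -[leLHS]mulr_natr.
rewrite ler_wpM2l ?mulr_ge0 ?sqr_ge0// ler_nat -cardsE.
exact: card_band_le.
Qed.

(** * Independence of blocks of innovations *)

(** Dynkin's argument: the events independent of a fixed [B] form a lambda-system. Measurability is
    carried along because the identities for differences and increasing limits rely on it. *)
Lemma indep_sigma_of_pi_system {d : measure_display} {T : measurableType d} {R : realType}
    (P : probability T R) (G : set (set T)) (B : set T) :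
  setI_closed G -> G `<=` measurable -> measurable B ->
  (forall A, G A -> P (A `&` B) = P A * P B)%E ->
  forall A, <<s G >> A -> measurable A /\ (P (A `&` B) = P A * P B)%E.
Proof.
move=> GI Gm mB GB.
pose L := [set A : set T | measurable A /\ (P (A `&` B) = P A * P B)%E].
suff : <<s G >> `<=` L by [].
have fP C : measurable C -> P C \is a fin_num by move=> mC; exact: fin_num_measure.
apply: lambda_system_subset => //.
split => //.
- by split => //; rewrite setTI probability_setT mul1e.
- move=> A A' A'A [mA hA] [mA' hA']; split; first exact: measurableD.
  have -> : (A `\` A') `&` B = (A `&` B) `\` (A' `&` B).
    apply/seteqP; split=> x /=; first by move=> [[Ax A'x] Bx]; split => // -[].
    by move=> [[Ax Bx] h]; split => //; split => // A'x; exact: h.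
  have mAB : measurable (A `&` B) by exact: measurableI.
  have mA'B : measurable (A' `&` B) by exact: measurableI.
  have diffE X Y : measurable X -> measurable Y -> Y `<=` X -> P (X `\` Y) = (P X - P Y)%E.
    by move=> mX mY YX; rewrite measureD// ?setIidr// ltey_eq fP.
  rewrite !diffE//; last exact: setSI.
  by rewrite hA hA' muleBl ?fin_num_adde_defr ?fP//.
- move=> F ndF HF.
  have mF n : measurable (F n) by case: (HF n).
  have mUF : measurable (\bigcup_n F n) by exact: bigcupT_measurable.
  have mFB n : measurable (F n `&` B) by exact: measurableI.
  split=> //.
  have c1 : (P \o (fun n => F n `&` B)) @ \oo --> P (\bigcup_n F n `&` B).
    rewrite setI_bigcupl; apply: nondecreasing_cvg_mu => //.
      by apply: bigcupT_measurable.
    by move=> m n mn; apply/subsetPset; apply: setSI; apply/subsetPset/ndF.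
  have c2 : (P \o (fun n => F n `&` B)) @ \oo --> (P (\bigcup_n F n) * P B)%E.
    rewrite (_ : _ \o _ = fun n => (P (F n) * P B)%E); last first.
      by apply/funext => n /=; case: (HF n).
    by apply: cvgeZr; [exact: fP|exact: nondecreasing_cvg_mu].
  exact: cvg_unique c1 c2.
- by move=> A GA; split; [exact: Gm|exact: GB].
Qed.

(** Independence says that the joint law of [(f, g)] agrees with the product of the marginal laws on
    rectangles, hence everywhere by uniqueness of product measures; Fubini then splits the integral
    of [x y]. *)
Lemma integral_mul_indep {d : measure_display} {T : measurableType d} {R : realType}
    (P : probability T R) (f g : {mfun T >-> R}) :
  (forall A B : set R, measurable A -> measurable B ->
    P (f @^-1` A `&` g @^-1` B) = P (f @^-1` A) * P (g @^-1` B))%E ->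
  P.-integrable setT (EFin \o f) -> P.-integrable setT (EFin \o g) ->
  P.-integrable setT (fun w => (f w * g w)%:E) ->
  (\int[P]_w (f w * g w)%:E = (\int[P]_w (f w)%:E) * (\int[P]_w (g w)%:E))%E.
Proof.
move=> ind intf intg intfg.
have mh : measurable_fun setT (fun w => (f w, g w)) by exact: measurable_fun_pair.
pose h : {mfun T >-> (R * R)%type} := mfun_Sub (mem_set mh).
pose F (z : R * R) : \bar R := (z.1 * z.2)%:E.
have mF : measurable_fun setT F by apply/measurable_EFinP; exact: measurable_funM.
pose mu := distribution P f; pose nu := distribution P g.
have prodE X : measurable X -> (mu \x nu)%E X = distribution P h X.
  by apply: product_measure_unique => A B mA mB; rewrite /= -ind.
have intF : (mu \x nu)%E.-integrable setT F.
  apply/integrableP; split => //.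
  rewrite (eq_measure_integral (distribution P h)); last by move=> A mA _; exact: prodE.
  rewrite ge0_integral_distribution//; last exact: measurableT_comp.
  by have /integrableP[] := intfg.
have -> : (\int[P]_w (f w * g w)%:E = \int[distribution P h]_z F z)%E.
  by rewrite integral_distribution.
rewrite (eq_measure_integral (mu \x nu)%E); last first.
  by move=> A mA _; exact/esym/prodE.
rewrite -integral12_prod_meas1//.
have intmu : mu.-integrable setT EFin by apply: integrable_pushforward.
have intnu : nu.-integrable setT EFin by apply: integrable_pushforward.
have Ef : (\int[P]_w (f w)%:E = \int[mu]_x x%:E)%E by rewrite integral_distribution.
have Eg : (\int[P]_w (g w)%:E = \int[nu]_x x%:E)%E by rewrite integral_distribution.
rewrite Ef Eg; have fnu : (\int[nu]_x x%:E)%E \is a fin_num by exact: integrable_fin_num.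
transitivity (\int[mu]_x (x%:E * \int[nu]_y y%:E))%E.
  by apply: eq_integral => x _; rewrite -integralZl.
by rewrite -(fineK fnu) -integralZr.
Qed.

(** Padding by [setT] outside [S] puts the cylinders over different [S] on the same index type, so
    that two of them can be intersected coordinate by coordinate. *)
Definition cylinders {d : measure_display} {T : measurableType d} {I : finType}
  (G : I -> set (set T)) (S : {set I}) : set (set T) :=
  [set C | exists A : I -> set T, [/\ forall i, G i (A i),
    forall i, i \notin S -> A i = setT & C = \bigcap_(i in [set: I]) A i]].

Lemma setI_closed_cylinders {d : measure_display} {T : measurableType d} {I : finType}
    (G : I -> set (set T)) (S : {set I}) :
  (forall i, setI_closed (G i)) -> setI_closed (cylinders G S).
Proof.
move=> GI _ _ [A [GA SA ->]] [B [GB SB ->]]; exists (fun i => A i `&` B i); split.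
- by move=> i; exact: GI.
- by move=> i iS; rewrite SA// SB// setIT.
- by rewrite bigcapI.
Qed.

(** For two cylinders, at each index one of the two sides is [setT], so the product formula over [I]
    splits. The pi-lambda step then passes to the generated sigma-algebras, one argument at a
    time. *)
Lemma indep_cylinders {d : measure_display} {T : measurableType d} {R : realType}
    (P : probability T R) {I : finType} (G : I -> set (set T)) (S1 S2 : {set I}) :
  (forall i, setI_closed (G i)) -> (forall i, G i `<=` measurable) ->
  (forall A, (forall i, G i (A i)) ->
     P (\bigcap_(i in [set: I]) A i) = \prod_i P (A i))%E ->
  (forall i, i \in S1 -> i \notin S2) ->
  forall A B, <<s cylinders G S1 >> A -> <<s cylinders G S2 >> B ->
  (P (A `&` B) = P A * P B)%E.
Proof.
move=> GI Gm ind S12 A B sA sB.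
have cm S : cylinders G S `<=` measurable.
  move=> _ [C [GC _ ->]]; apply: fin_bigcap_measurable => // i _; exact: (Gm i).
have base C D : cylinders G S1 C -> cylinders G S2 D -> (P (C `&` D) = P C * P D)%E.
  move=> [A1 [GA SA ->]] [B1 [GB SB ->]]; rewrite -bigcapI !ind//; last first.
    by move=> i; exact: GI.
  rewrite -big_split/=; apply: eq_bigr => i _.
  have [iS1|iS1] := boolP (i \in S1); last by rewrite SA// setTI probability_setT mul1e.
  by rewrite SB ?setIT ?probability_setT ?mule1//; exact: S12.
have step D : cylinders G S2 D -> measurable A /\ (P (A `&` D) = P A * P D)%E.
  move=> cD; apply: (indep_sigma_of_pi_system _ _ _ _ sA).
  - exact: setI_closed_cylinders.
  - exact: (cm S1).
  - exact: (cm S2 _ cD).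
  - by move=> C cC; exact: base.
have mA : measurable A.
  apply: (smallest_sub (sigma_algebra_measurable T) _ sA); exact: (cm S1).
have [] := @indep_sigma_of_pi_system _ _ _ P (cylinders G S2) A _ _ _ _ B sB => //.
- exact: setI_closed_cylinders.
- by move=> D /step[_]; rewrite setIC muleC.
- by rewrite setIC => _ ->; rewrite muleC.
Qed.

Lemma setI_closed_sigma {T : Type} (G : set (set T)) : setI_closed <<s G >>.
Proof.
have [h _] := @sigma_algebraP T setT <<s G >> (fun X _ => @subsetT _ X).
by have [] := h (smallest_sigma_algebra setT G).
Qed.

Lemma sigma_setT {T : Type} (G : set (set T)) : <<s G >> setT.
Proof.
have [h _] := @sigma_algebraP T setT <<s G >> (fun X _ => @subsetT _ X).
by have [] := h (smallest_sigma_algebra setT G).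
Qed.

Definition window_gen {d : measure_display} {T : measurableType d} {R : realType}
  {D L : nat} (eps : 'I_L.+1 -> int -> 'I_D -> T -> R) (a b : int) : set (set T) :=
  \bigcup_(x in [set x : 'I_L.+1 * int * 'I_D | a <= x.1.2 <= b])
     preimage_set_system setT (eps x.1.1 x.1.2 x.2) measurable.

(** Independence is given in two layers, between the sequences [l] and between the times of each
    sequence. Both windows fit in a finite grid of pairs (sequence, time), on which the product
    formula follows by factoring over [l] and then over times. *)
Lemma indep_windows {d : measure_display} {T : measurableType d} {R : realType}
    (P : probability T R) {D L : nat} (eps : 'I_L.+1 -> int -> 'I_D -> T -> R)
    (a1 b1 a2 b2 : int) :
  (forall l t k, measurable_fun setT (eps l t k)) ->
  (forall l, indep_family P (fun t : int => sigma_gen (fun k : 'I_D => eps l t k))) ->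
  indep_family P (fun l : 'I_L.+1 =>
     sigma_gen (fun tk : int * 'I_D => eps l tk.1 tk.2)) ->
  b1 < a2 ->
  forall A B, <<s window_gen eps a1 b1 >> A -> <<s window_gen eps a2 b2 >> B ->
  (P (A `&` B) = P A * P B)%E.
Proof.
move=> meps indt indl b1a2 A B sA sB.
(* Times are coded as offsets in ['I_N] from the earlier start [t0], with [N] large enough to reach
   the later end. *)
pose t0 := Num.min a1 a2; pose N := `|Num.max b1 b2 - t0|.+1%N.
pose G (i : 'I_L.+1 * 'I_N) := sigma_gen (fun k : 'I_D => eps i.1 (t0 + i.2%:Z) k).
pose S (a b : int) := [set i : 'I_L.+1 * 'I_N | a <= t0 + i.2%:Z <= b]%SET.
have winS a b : t0 <= a -> b <= Num.max b1 b2 ->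
    <<s window_gen eps a b >> `<=` <<s cylinders G (S a b) >>.
  move=> ta bb; apply: smallest_sub; first exact: smallest_sigma_algebra.
  move=> C [[[l t] k] /= /andP[h1 h2] CE].
  have iN : (`|t - t0| < N)%N.
    rewrite /N ltnS; move: ta bb h1 h2; clear; lia.
  have tE : t0 + (`|t - t0|%N)%:Z = t.
    rewrite gez0_abs ?subr_ge0 ?(le_trans ta)//; lia.
  pose i0 : 'I_L.+1 * 'I_N := (l, Ordinal iN).
  apply: sub_sigma_algebra.
  exists (fun i => if i == i0 then C else setT); split.
  - move=> i; case: eqVneq => [->|_]; last exact: sigma_setT.
    by apply: sub_sigma_algebra; exists k => //; rewrite /i0/= tE.
  - move=> i; case: eqVneq => [->|//]; rewrite inE/= tE h1 h2//.
  - apply/seteqP; split => w /=.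
      by move=> Cw i _; case: eqVneq.
    by move=> /(_ i0 Logic.I); rewrite eqxx.
apply: (@indep_cylinders _ _ _ P _ G (S a1 b1) (S a2 b2)).
- by move=> i; exact: setI_closed_sigma.
- move=> i; apply: smallest_sub; first exact: sigma_algebra_measurable.
  by move=> C [k _ [Y mY <-]]; exact: meps.
- move=> C GC.
  (* Grouping the events of one sequence over all times keeps them in the sigma-algebra of that
     sequence, which is what the outer layer of independence accepts. *)
  have GlC l : sigma_gen (fun tk : int * 'I_D => eps l tk.1 tk.2)
      (\bigcap_(a in [set: 'I_N]) C (l, a)).
    apply: (@fin_bigcap_measurable _ (g_sigma_algebraType _)) => // a _.
    apply: (smallest_sub (smallest_sigma_algebra _ _) _ (GC (l, a))).
    move=> Y [k _ hY]; apply: sub_sigma_algebra; by exists (t0 + a%:Z, k).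
  have -> : \bigcap_(i in [set: 'I_L.+1 * 'I_N]) C i =
      \bigcap_(l in [set: 'I_L.+1]) \bigcap_(a in [set: 'I_N]) C (l, a).
    apply/seteqP; split => w h; first by move=> l _ a _; exact: h.
    by move=> [l a] _; exact: h.
  transitivity (\prod_l \prod_a P (C (l, a)))%E; last first.
    by rewrite pair_bigA/=; apply: eq_bigr => -[].
  rewrite (indl _ id (@inj_id _) _ GlC).
  apply: eq_bigr => l _; apply: (indt l N (fun a : 'I_N => t0 + a%:Z)) => //.
    by move=> x y /addrI[/ord_inj].
  by move=> a; exact: (GC (l, a)).
- move=> i; rewrite !inE/= => /andP[_ h1]; apply/negP => /andP[h2 _].
  by have := lt_le_trans b1a2 (le_trans h2 h1); rewrite ltxx.
- by apply: (winS _ _ _ _ _ sA); rewrite ?ge_min ?le_max lexx.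
- by apply: (winS _ _ _ _ _ sB); rewrite ?ge_min ?le_max lexx orbT.
Qed.

(** * Truncation of the error process *)

(** Truncation acts on the coefficients and not on the sums, so [linproc], [Ufield] and [errproc]
    apply verbatim to the truncated model. *)
Definition ctrunc {R : realType} {d L : nat} (n : nat) (Cc : 'I_L.+1 -> nat -> 'M[R]_d)
  (l : 'I_L.+1) (j : nat) : 'M[R]_d := if (j < n)%N then Cc l j else 0.

Lemma linproc_ctrunc {T : Type} {R : realType} {d L : nat}
    (Cc : 'I_L.+1 -> nat -> 'M[R]_d) (eps : 'I_L.+1 -> int -> 'I_d -> T -> R)
    (n : nat) l t nu w :
  linproc (ctrunc n Cc) eps l t nu w =
  \sum_(j < n) \sum_(k < d) Cc l j nu k * eps l (t - (j:nat)%:Z) k w.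
Proof.
rewrite /linproc; apply/cvg_lim => //.
apply: cvg_near_cst.
exists n => // N /= nN.
rewrite -(big_mkord xpredT 
  (fun j => \sum_(k < d) ctrunc n Cc l j nu k * eps l (t - j%:Z) k w)).
rewrite (big_cat_nat (n := n))//= big_mkord [X in _ + X]big1_seq ?addr0.
  apply: eq_bigr => j _; apply: eq_bigr => k _; by rewrite /ctrunc ltn_ord.
move=> j /andP[_]; rewrite mem_index_iota => /andP[nj _].
by rewrite big1// => k _; rewrite /ctrunc ltnNge nj/= mxE mul0r.
Qed.

Lemma measurable_linproc {dT : measure_display} {T : measurableType dT} {R : realType}
    {d L : nat} (Cc : 'I_L.+1 -> nat -> 'M[R]_d) (eps : 'I_L.+1 -> int -> 'I_d -> T -> R)
    l t nu : (forall l t k, measurable_fun setT (eps l t k)) ->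
  measurable_fun setT (linproc Cc eps l t nu).
Proof.
move=> meps; apply: measurable_fun_limn => n.
by apply: measurable_sum => j; apply: measurable_sum => k; exact: measurable_funM.
Qed.

(** Only the innovations that really occur are asked to be measurable. This allows [T] to carry the
    smaller sigma-algebra of a time window, in which other innovations need not be measurable. *)
Lemma measurable_linproc_ctrunc {dT : measure_display} {T : measurableType dT}
    {R : realType} {d L : nat} (Cc : 'I_L.+1 -> nat -> 'M[R]_d)
    (eps : 'I_L.+1 -> int -> 'I_d -> T -> R) (n : nat) l t nu :
  (forall j k, (j < n)%N -> measurable_fun setT (eps l (t - j%:Z) k)) ->
  measurable_fun setT (linproc (ctrunc n Cc) eps l t nu).
Proof.
move=> meps; rewrite (_ : linproc _ _ _ _ _ = fun w =>
    \sum_(j < n) \sum_(k < d) Cc l j nu k * eps l (t - (j:nat)%:Z) k w); last first.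
  by apply/funext => w; exact: linproc_ctrunc.
apply: measurable_sum => j; apply: measurable_sum => k.
by apply: measurable_funM => //; exact: meps.
Qed.

Lemma measurable_Ufield {dT : measure_display} {T : measurableType dT} {R : realType}
    {d L q : nat} (phi : 'I_d -> 'I_L -> R) (dist : ('I_q -> R) -> ('I_q -> R) -> R)
    (r : 'I_L -> ('I_q -> R)) (Cc : 'I_L.+1 -> nat -> 'M[R]_d)
    (eps : 'I_L.+1 -> int -> 'I_d -> T -> R) s t nu :
  (forall l, measurable_fun setT (linproc Cc eps l t nu)) ->
  measurable_fun setT (Ufield phi dist r Cc eps s t nu).
Proof.
move=> ml; apply: measurable_funD => //; apply: measurable_sum => l.
exact: measurable_funM.
Qed.

Lemma measurable_Umat_comp {dT : measure_display} {T : measurableType dT} {R : realType}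
    {d L q : nat} (m : nat)
    (H : 'I_d -> 'M[R]_(d, m.+1) -> R) (LH : R)
    (phi : 'I_d -> 'I_L -> R) (dist : ('I_q -> R) -> ('I_q -> R) -> R)
    (r : 'I_L -> ('I_q -> R)) (Cc : 'I_L.+1 -> nat -> 'M[R]_d)
    (eps : 'I_L.+1 -> int -> 'I_d -> T -> R) (s : 'I_q -> R) t nu :
  (forall k A B, `|H k A - H k B| <= LH * frob (A - B)) ->
  (forall l k i, (k <= m)%N -> measurable_fun setT (linproc Cc eps l (t - k%:Z) i)) ->
  measurable_fun setT (fun w => H nu (Umat m phi dist r Cc eps s t w)).
Proof.
move=> lipH ml; apply: (measurable_lipschitz_comp (lipH nu)) => i k.
by apply: measurable_Ufield => l; apply: ml; rewrite -ltnS.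
Qed.

Lemma second_moment_frob_le {dT : measure_display} {T : measurableType dT}
    {R : realType} (P : probability T R) (m n : nat) (Z : 'I_m -> 'I_n -> T -> R) (K : R) :
  (forall i j, measurable_fun setT (Z i j)) ->
  (forall i j, second_moment P (Z i j) <= K%:E)%E ->
  (second_moment P (fun w => frob (\matrix_(i, j) Z i j w)) <= ((m * n)%:R * K)%:E)%E.
Proof.
move=> mZ ZK; rewrite /second_moment.
under eq_integral => w _.
  rewrite sqr_frob -sumEFin.
  under eq_bigr => i _ do under eq_bigr => j _ do rewrite mxE.
  under eq_bigr => i _ do rewrite -sumEFin.
  over.
rewrite ge0_integral_sum//; last 2 first.
- by move=> i; apply: emeasurable_sum => j; exact: measurable_sqr_EFin.
- by move=> i w _; apply: sume_ge0 => j _; rewrite lee_fin sqr_ge0.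
apply: (@le_trans _ _ (\sum_(i < m) \sum_(j < n) K%:E)%E).
  apply: lee_sum => i _; rewrite ge0_integral_sum//; last 2 first.
  - by move=> j; exact: measurable_sqr_EFin.
  - by move=> j w _; rewrite lee_fin sqr_ge0.
  by apply: lee_sum => j _; exact: ZK.
under eq_bigr do rewrite sumEFin.
by rewrite sumEFin lee_fin !sumr_const !card_ord -mulrnA mulr_natl mulnC.
Qed.

Lemma second_moment_linproc_tail {dT : measure_display} {T : measurableType dT}
    {R : realType} (P : probability T R) {d L : nat} (Cc : 'I_L.+1 -> nat -> 'M[R]_d)
    (eps : 'I_L.+1 -> int -> 'I_d -> T -> R) (C M : R) :
  (forall l t k, measurable_fun setT (eps l t k)) ->
  (forall l t k, second_moment P (eps l t k) <= M%:E)%E ->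
  (forall l j k k', `|Cc l j k k'| <= C * (j.+1 * j.+2)%:R^-1) ->
  forall n l t nu, (second_moment P (fun w => linproc Cc eps l t nu w
    - linproc (ctrunc n Cc) eps l t nu w)%R <= (d%:R ^+ 2 * (C ^+ 2 * M) / n.+1%:R)%:E)%E.
Proof.
move=> meps hM hC n l t nu.
pose x j w := \sum_(k < d) Cc l j nu k * eps l (t - (j:nat)%:Z) k w.
have mx j : measurable_fun setT (x j).
  by apply: measurable_sum => k; exact: measurable_funM.
under [X in second_moment _ X]eq_fun do rewrite linproc_ctrunc.
apply: (second_moment_series_tail mx) => j.
rewrite -mulrA; apply: second_moment_sum_le.
  by move=> k; exact: measurable_funM.
move=> k; rewrite second_momentZ//.
apply: (@le_trans _ _ (((C * (j.+1 * j.+2)%:R^-1) ^+ 2)%:E * M%:E)%E).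
  apply: lee_pmul; rewrite ?lee_fin ?sqr_ge0 ?second_moment_ge0//.
  rewrite -real_normK ?num_real// ler_pXn2r ?nnegrE//.
  exact: le_trans (normr_ge0 _) (hC l j nu k).
by rewrite -EFinM lee_fin exprMn mulrAC.
Qed.

Lemma second_moment_Ufield_tail {dT : measure_display} {T : measurableType dT}
    {R : realType} (P : probability T R) {d L q : nat}
    (phi : 'I_d -> 'I_L -> R) (dist : ('I_q -> R) -> ('I_q -> R) -> R)
    (r : 'I_L -> ('I_q -> R)) (Cc : 'I_L.+1 -> nat -> 'M[R]_d)
    (eps : 'I_L.+1 -> int -> 'I_d -> T -> R) (s : 'I_q -> R) (C M F : R) :
  (forall l t k, measurable_fun setT (eps l t k)) ->
  (forall l t k, second_moment P (eps l t k) <= M%:E)%E ->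
  (forall l j k k', `|Cc l j k k'| <= C * (j.+1 * j.+2)%:R^-1) ->
  (forall k l, `|phi k l * dist s (r l)| <= F) ->
  forall n t nu, (second_moment P (fun w => Ufield phi dist r Cc eps s t nu w
    - Ufield phi dist r (ctrunc n Cc) eps s t nu w)%R
   <= (2 * (L%:R ^+ 2 * F ^+ 2 + 1) * (d%:R ^+ 2 * (C ^+ 2 * M)) / n.+1%:R)%:E)%E.
Proof.
move=> meps hM hC hF n t nu.
have tail := second_moment_linproc_tail meps hM hC n.
set D := d%:R ^+ 2 * (C ^+ 2 * M) / n.+1%:R in tail *.
pose y l w := linproc Cc eps l t nu w - linproc (ctrunc n Cc) eps l t nu w.
have my l : measurable_fun setT (y l).
  by apply: measurable_funB; exact: measurable_linproc.
rewrite (_ : (fun w => _) = (fun w =>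
   \sum_(l < L) phi nu l * dist s (r l) * y (lift ord0 l) w + y ord0 w)); last first.
  apply/funext => w; rewrite /Ufield /y.
  under [in RHS]eq_bigr do rewrite mulrBr.
  by rewrite sumrB; ring.
rewrite (_ : 2 * _ * _ / _ = 2 * (L%:R ^+ 2 * (F ^+ 2 * D) + D)); last first.
  by rewrite /D; ring.
apply: second_moment_add_le => //; last exact: tail.
  by apply: measurable_sum => l; exact: measurable_funM.
apply: second_moment_sum_le; first by move=> l; exact: measurable_funM.
move=> l; rewrite second_momentZ// (EFinM (F ^+ 2)); apply: lee_pmul.
- by rewrite lee_fin sqr_ge0.
- exact: second_moment_ge0.
- rewrite lee_fin -real_normK ?num_real// ler_pXn2r ?nnegrE//.
  exact: le_trans (normr_ge0 _) (hF nu l).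
- exact: tail.
Qed.

(** The point is uniformity: one [K] serves all [n] and all [t]. Times are positive because the
    locations are controlled only there; the lags of [Umat] keep the location [s t] and shift only
    the innovations. *)
Lemma errproc_truncation {dT : measure_display} {T : measurableType dT} {R : realType}
    (P : probability T R) {d L q m : nat} (H : 'I_d -> 'M[R]_(d, m.+1) -> R)
    (phi : 'I_d -> 'I_L -> R) (dist : ('I_q -> R) -> ('I_q -> R) -> R)
    (r : 'I_L -> ('I_q -> R)) (Cc : 'I_L.+1 -> nat -> 'M[R]_d)
    (eps : 'I_L.+1 -> int -> 'I_d -> T -> R) (s : int -> ('I_q -> R)) (C M F LH : R)
    (nu : 'I_d) :
  (forall l t k, measurable_fun setT (eps l t k)) ->
  (forall l t k, second_moment P (eps l t k) <= M%:E)%E ->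
  (forall l j k k', `|Cc l j k k'| <= C * (j.+1 * j.+2)%:R^-1) ->
  (forall t : int, 0 < t -> forall k l, `|phi k l * dist (s t) (r l)| <= F) ->
  (forall k A B, `|H k A - H k B| <= LH * frob (A - B)) ->
  exists2 K : R, 0 <= K & forall (n : nat) (t : int), 0 < t ->
   [/\ measurable_fun setT (errproc P H phi dist r Cc eps s t nu),
       measurable_fun setT (errproc P H phi dist r (ctrunc n Cc) eps s t nu),
       (second_moment P (fun w => errproc P H phi dist r Cc eps s t nu w
          - errproc P H phi dist r (ctrunc n Cc) eps s t nu w)%R <= (K / n.+1%:R)%:E)%E,
       (second_moment P (errproc P H phi dist r (ctrunc n Cc) eps s t nu) <= K%:E)%E &
       (\int[P]_w (errproc P H phi dist r (ctrunc n Cc) eps s t nu w)%:E = 0)%E].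
Proof.
move=> meps hM hC hF lipH.
pose Y c t w := H nu (Umat m phi dist r c eps (s t) t w).
have mY c t : measurable_fun setT (Y c t).
  by apply: (measurable_Umat_comp (LH := LH)) => // l k i _; exact: measurable_linproc.
pose KU := 2 * (L%:R ^+ 2 * F ^+ 2 + 1) * (d%:R ^+ 2 * (C ^+ 2 * M)).
pose K0 := LH ^+ 2 * ((d * m.+1)%:R * KU).
pose D n t w := Y Cc t w - Y (ctrunc n Cc) t w.
have mD n t : measurable_fun setT (D n t) by exact: measurable_funB.
have hD n t : 0 < t -> (second_moment P (D n t) <= (K0 / n.+1%:R)%:E)%E.
  move=> t0.
  pose Z (i : 'I_d) (k : 'I_m.+1) w := Ufield phi dist r Cc eps (s t) (t - (k:nat)%:Z) i w
     - Ufield phi dist r (ctrunc n Cc) eps (s t) (t - (k:nat)%:Z) i w.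
  have mZ i k : measurable_fun setT (Z i k).
    by apply: measurable_funB; apply: measurable_Ufield => l; exact: measurable_linproc.
  have mfZ : measurable_fun setT (fun w => frob (\matrix_(i, k) Z i k w)).
    apply: measurableT_comp; first exact: measurable_sqrtr.
    apply: measurable_sum => i; apply: measurable_sum => j.
    apply: measurable_funX; rewrite (_ : (fun w => _) = Z i j)//.
    by apply/funext => w; rewrite mxE.
  apply: (@le_trans _ _ (second_moment P (fun w => LH * frob (\matrix_(i, k) Z i k w)))).
    apply: le_second_moment => //; first exact: measurable_funM.
    move=> w; apply: (le_trans (lipH nu _ _)).
    rewrite (_ : Umat _ _ _ _ _ _ _ _ _ - _ = \matrix_(i, k) Z i k w) ?ler_norm//.
    by apply/matrixP => i k; rewrite !mxE.
  rewrite second_momentZ// (_ : K0 / _ = LH ^+ 2 * ((d * m.+1)%:R * (KU / n.+1%:R))).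
    rewrite (EFinM (LH ^+ 2)) lee_wpmul2l ?lee_fin ?sqr_ge0//.
    apply: second_moment_frob_le => // i k.
    exact: (second_moment_Ufield_tail meps hM hC (hF t t0)).
  by rewrite /K0 !mulrA.
have K00 : 0 <= K0.
  by have := le_trans (second_moment_ge0 _ _) (hD 0%N 1 isT); rewrite lee_fin invr1 mulr1.
(* With no terms kept the field is the zero matrix, so [Y Cc t] is [D 0 t] plus the number [H nu 0];
   its second moment bound [K1] comes from this. *)
have Y0 t w : Y (ctrunc 0 Cc) t w = H nu 0.
  congr (H nu _); apply/matrixP => i k; rewrite !mxE /Ufield linproc_ctrunc big_ord0 addr0.
  by rewrite big1// => l _; rewrite linproc_ctrunc big_ord0 mulr0.
pose K1 := 2 * (K0 + H nu 0 ^+ 2); pose K := 2 * (K1 + K0).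
have K10 : 0 <= K1 by rewrite mulr_ge0// addr_ge0// sqr_ge0.
have YK1 t : 0 < t -> (second_moment P (Y Cc t) <= K1%:E)%E.
  move=> t0; rewrite (_ : Y Cc t = fun w => D 0%N t w + H nu 0); last first.
    by apply/funext => w; rewrite /D Y0 subrK.
  apply: second_moment_add_le => //; last by rewrite second_moment_cst.
  by have := hD 0%N t t0; rewrite invr1 mulr1.
have K0n n : K0 / n.+1%:R <= K0 by rewrite ler_piMr// invf_le1// ler1n.
have YnK n t : 0 < t -> (second_moment P (Y (ctrunc n Cc) t) <= K%:E)%E.
  move=> t0; rewrite (_ : Y _ t = fun w => Y Cc t w + (-1) * D n t w); last first.
    by apply/funext => w; rewrite /D mulN1r opprB addrCA subrr addr0.
  apply: second_moment_add_le => //; [exact: measurable_funM|exact: YK1|].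
  rewrite second_momentZ// sqrrN expr1n mul1e (le_trans (hD n t t0))// lee_fin.
  exact: K0n.
exists K; first by rewrite mulr_ge0// addr_ge0.
move=> n t t0; have := YnK n t t0; have := YK1 t t0; have := hD n t t0 => hDt hY hYn.
have mE c : measurable_fun setT (errproc P H phi dist r c eps s t nu).
  by apply: measurable_funB => //; exact: mY.
split => //.
(* The two errors have different centring constants, but their difference is [D n t] minus its own
   mean, and centring does not increase a second moment. *)
- have -> : (fun w => errproc P H phi dist r Cc eps s t nu w
     - errproc P H phi dist r (ctrunc n Cc) eps s t nu w)
     = fun w => D n t w - fine 'E_P[D n t].
    have i1 := integrable_second_moment (mY Cc t) hY.
    have i2 := integrable_second_moment (mY (ctrunc n Cc) t) hYn.
    rewrite [in RHS]unlock (_ : (\int[P]_w (D n t w)%:E =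
        \int[P]_w (Y Cc t w)%:E - \int[P]_w (Y (ctrunc n Cc) t w)%:E)%E); last first.
      by rewrite -integralB_EFin.
    rewrite fineB ?integrable_fin_num//.
    by apply/funext => w; rewrite /errproc unlock /D /Y; ring.
  apply: (le_trans (second_moment_center_le (mD n t) hDt)).
  apply: (le_trans hDt); rewrite lee_fin ler_wpM2r ?invr_ge0//.
  by rewrite /K /K1; have := sqr_ge0 (H nu 0); lra.
- exact: le_trans (second_moment_center_le (mY (ctrunc n Cc) t) hYn) hYn.
- exact: (integral_center0 (mY (ctrunc n Cc) t) hYn).
Qed.

(** The truncated error at [u] looks back over [m] lags of [H] and fewer than [n] further steps of
    the moving averages, so it is a function of the innovations dated from [u - (n + m)] to [u]. The
    gap makes the two windows disjoint, and the product of the means vanishes. *)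
Lemma errproc_ctrunc_uncorrelated {dT : measure_display} {T : measurableType dT}
    {R : realType} (P : probability T R) {d L q m : nat}
    (H : 'I_d -> 'M[R]_(d, m.+1) -> R)
    (phi : 'I_d -> 'I_L -> R) (dist : ('I_q -> R) -> ('I_q -> R) -> R)
    (r : 'I_L -> ('I_q -> R)) (Cc : 'I_L.+1 -> nat -> 'M[R]_d)
    (eps : 'I_L.+1 -> int -> 'I_d -> T -> R) (s : int -> ('I_q -> R)) (LH K : R)
    (nu : 'I_d) (n : nat) (t t' : int) :
  (forall l t k, measurable_fun setT (eps l t k)) ->
  (forall l, indep_family P (fun t : int => sigma_gen (fun k : 'I_d => eps l t k))) ->
  indep_family P (fun l : 'I_L.+1 =>
     sigma_gen (fun tk : int * 'I_d => eps l tk.1 tk.2)) ->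
  (forall k A B, `|H k A - H k B| <= LH * frob (A - B)) ->
  t + (n + m)%:Z < t' ->
  let e u := errproc P H phi dist r (ctrunc n Cc) eps s u nu in
  (second_moment P (e t) <= K%:E)%E -> (second_moment P (e t') <= K%:E)%E ->
  (\int[P]_w (e t w)%:E = 0)%E ->
  (\int[P]_w (e t w * e t' w)%:E = 0)%E.
Proof.
move=> meps indt indl lipH tt' e etK et'K et0.
(* Dependence on a window is expressed as measurability on the same space equipped with the window's
   sigma-algebra. *)
have mwin u : measurable_fun (setT : set (g_sigma_algebraType
    (window_gen eps (u - (n + m)%:Z) u))) (e u).
  apply: measurable_funB => //.
  apply: (measurable_Umat_comp (LH := LH)) => // l k i km.
  apply: measurable_linproc_ctrunc => j k' jn _ Y mY; rewrite setTI.
  apply: sub_sigma_algebra; exists (l, u - k%:Z - j%:Z, k'); last by exists Y => //; rewrite setTI.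
  by move: km jn => /=; lia.
have me u : measurable_fun setT (e u).
  apply: measurable_funB => //; apply: (measurable_Umat_comp (LH := LH)) => // l k i _.
  exact: measurable_linproc.
pose f : {mfun T >-> R} := mfun_Sub (mem_set (me t)).
pose g : {mfun T >-> R} := mfun_Sub (mem_set (me t')).
rewrite (@integral_mul_indep _ _ _ P f g).
- by rewrite [X in (X * _)%E]et0 mul0e.
- move=> A B mA mB; apply: (indep_windows meps indt indl (a1 := t - (n + m)%:Z) (b1 := t)
    (a2 := t' - (n + m)%:Z) (b2 := t')).
  + by move: tt'; lia.
  + by have := mwin t measurableT A mA; rewrite setTI.
  + by have := mwin t' measurableT B mB; rewrite setTI.
- exact: (integrable_second_moment (me t) etK).
- exact: (integrable_second_moment (me t') et'K).
- exact: (integrable_mul (me t) (me t') etK et'K).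
Qed.

(** * Rates and the deviation bound *)

Lemma sqr_le_1DpowR {R : realType} (x delta : R) : 0 < delta ->
  x ^+ 2 <= 1 + `|x| `^ (2 + delta).
Proof.
move=> d0; rewrite -real_normK ?num_real//.
have [x1|x1] := leP `|x| 1.
  apply: (@le_trans _ _ 1); first exact: exprn_ile1.
  by rewrite lerDl powR_ge0.
have h : `|x| `^ 2 <= `|x| `^ (2 + delta) by apply: (ler_powR (ltW x1)); rewrite lerDl ltW.
by rewrite -powR_mulrn// (le_trans h)// lerDr.
Qed.

Lemma second_moment_le_of_powR {dT : measure_display} {T : measurableType dT}
    {R : realType} (P : probability T R) (f : T -> R) (delta M : R) :
  0 < delta -> measurable_fun setT f ->
  (\int[P]_w (`|f w| `^ (2 + delta))%:E <= M%:E)%E ->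
  (second_moment P f <= (1 + M)%:E)%E.
Proof.
move=> d0 mf fM.
have mp : measurable_fun setT (fun w => (`|f w| `^ (2 + delta))%:E).
  apply/measurable_EFinP.
  apply: (measurableT_comp (measurable_powR (2 + delta))).
  exact: measurableT_comp.
apply: (@le_trans _ _ (\int[P]_w (1%:E + (`|f w| `^ (2 + delta))%:E))%E).
  apply: ge0_le_integral => //.
  - by move=> w _; rewrite lee_fin sqr_ge0.
  - exact: measurable_sqr_EFin.
  - exact: emeasurable_funD.
  - by move=> w _; rewrite -EFinD lee_fin sqr_le_1DpowR.
by rewrite ge0_integralD// integral_cst//= probability_setT mule1 EFinD leeD2l.
Qed.

(** The exponent is lowered to 2, and [(j+1)(j+2) <= 6 max(j,1)^2], with equality at [j = 1]. *)
Lemma polynomial_decay_le {R : realType} (theta : R) (j : nat) : 0 < theta ->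
  (maxn j 1)%:R `^ (- (7%:R / 2%:R) - theta) <= 6%:R * (j.+1 * j.+2)%:R^-1 :> R.
Proof.
move=> th0; set y := (maxn j 1)%:R.
have y1 : 1 <= y by rewrite ler1n leq_max orbT.
apply: (@le_trans _ _ (y `^ (- 2%:R))); first by apply: ler_powR => //; lra.
rewrite powRN powR_mulrn ?(le_trans ler01)//.
rewrite ler_pdivlMr ?ltr0n// mulrC ler_pdivrMr ?exprn_gt0 ?(lt_le_trans ltr01)//.
by rewrite /y -natrX -natrM ler_nat; case: j {y y1} => [|j]//=; lia.
Qed.

(** Eighth power of [y <= expR y] at [y = x / 8]. The exponent 8 is the one of [((ln T)^2)^4]. *)
Lemma expr8_le_expR {R : realType} (x : R) : 0 <= x -> x ^+ 8 <= 8%:R ^+ 8 * expR x.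
Proof.
move=> x0; have -> : x = 8%:R * (x / 8%:R) by field.
rewrite expRM_natl exprMn ler_wpM2l ?exprn_ge0// ler_pXn2r ?nnegrE ?expR_ge0 ?divr_ge0//.
by rewrite (le_trans _ (expR_ge1Dx _))// lerDr.
Qed.

Lemma eventually_pow4_le {R : realType} (p : nat -> nat) (a : R) : 0 < a < 1 ->
  ((fun T => (p T)%:R : R) @ \oo --> +oo) ->
  (fun T : nat => ln (p T)%:R * Num.sqrt (p T)%:R / (ln (T%:R : R)) `^ (1 - a))
       @ \oo --> (0 : R) ->
  \forall T \near \oo, (p T)%:R ^+ 4 <= 8%:R ^+ 8 * (T%:R : R).
Proof.
move=> /andP[a0 a1] /cvgryPge/(_ (expR 1)) p1 /cvgr0_norm_le/(_ 1 ltr01) h.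
have T1 : \forall T \near \oo, expR 1 <= (T%:R : R).
  by move/cvgryPge : (@cvgr_idn R); exact.
near=> T.
have lp : 1 <= ln ((p T)%:R : R).
  have e1 : expR 1 <= ((p T)%:R : R) by near: T.
  by rewrite -[leLHS]expRK ler_ln ?posrE ?expR_gt0// (lt_le_trans (expR_gt0 _) e1).
have Tpos : 0 < (T%:R : R).
  have e1 : expR 1 <= (T%:R : R) by near: T.
  exact: lt_le_trans (expR_gt0 _) e1.
have lT : 1 <= ln (T%:R : R).
  have e1 : expR 1 <= (T%:R : R) by near: T.
  by rewrite -[leLHS]expRK ler_ln ?posrE ?expR_gt0.
have lT0 : 0 < ln (T%:R : R) by exact: lt_le_trans lT.
have : ln (p T)%:R * Num.sqrt (p T)%:R / ln (T%:R : R) `^ (1 - a) <= 1.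
  by apply: le_trans (ler_norm _) _; near: T.
rewrite ler_pdivrMr ?powR_gt0// mul1r => h1.
have h2 : Num.sqrt ((p T)%:R : R) <= ln (T%:R : R).
  apply: (@le_trans _ _ (ln (p T)%:R * Num.sqrt (p T)%:R)).
    by rewrite ler_peMl ?sqrtr_ge0.
  by apply: (le_trans h1); apply: ler1_powR => //; lra.
rewrite -(lnK Tpos) (le_trans _ (expr8_le_expR (ltW lT0)))//.
rewrite -[(p T)%:R]sqr_sqrtr// -exprM ler_pXn2r ?nnegrE ?sqrtr_ge0//.
exact: ltW.
Unshelve. all: by end_near.
Qed.

Lemma measurable_eucl_ols {dT : measure_display} {Om : measurableType dT} {R : realType}
    {T p : nat} (X : 'M[R]_(T, p)) (b : 'cV[R]_p) (e : int -> Om -> R) :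
  (forall i : 'I_T, measurable_fun setT (e (i.+1)%:Z)) ->
  measurable_fun setT (fun w => eucl (ols X b (errvec e T w) - b)).
Proof.
move=> me; apply: measurableT_comp; first exact: measurable_sqrtr.
apply: measurable_sum => j; apply: measurable_funX.
rewrite (_ : (fun w => _) = (fun w => \sum_(i < T) (invmx (X^T *m X) *m X^T) j i *
    ((X *m b) i 0 + e (i.+1)%:Z w) - b j 0)).
  apply: measurable_funB => //; apply: measurable_sum => i; apply: measurable_funM => //.
  exact: measurable_funD.
apply/funext => w; rewrite /ols [LHS]mxE [X in X + _]mxE [X in _ + X]mxE.
by congr (_ - _); apply: eq_bigr => i _; congr (_ * _); rewrite [LHS]mxE [in X in _ + X]mxE.
Qed.

(** Here [e'] is an abstract approximation of [e] with covariances of range [k]. For [e - e']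
    Cauchy-Schwarz over time gives [B^2 A] per coordinate, with the powers of [T] cancelling; for
    [e'] the band bound gives the gain [(2k+1) / T]. *)
Lemma probability_ols_error_le {dT : measure_display} {Om : measurableType dT}
    {R : realType} (P : probability Om R) {T p : nat} (X : 'M[R]_(T, p)) (b : 'cV[R]_p)
    (e e' : int -> Om -> R) (k : nat) (B A K lo c : R) :
  (0 < T)%N -> 0 < lo -> 0 < c ->
  (forall a, eigenvalue (T%:R^-1 *: (X^T *m X)) a -> lo <= a) ->
  (forall i j, `|X i j| <= B) ->
  (forall i : 'I_T, measurable_fun setT (e (i.+1)%:Z)) ->
  (forall i : 'I_T, measurable_fun setT (e' (i.+1)%:Z)) ->
  (forall i : 'I_T,
     second_moment P (fun w => e (i.+1)%:Z w - e' (i.+1)%:Z w)%R <= A%:E)%E ->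
  (forall i : 'I_T, second_moment P (e' (i.+1)%:Z) <= K%:E)%E ->
  (forall i j : 'I_T, (i + k < j)%N ->
     (\int[P]_w (e' (i.+1)%:Z w * e' (j.+1)%:Z w)%:E = 0)%E) ->
  (P [set w | (c < eucl (ols X b (errvec e T w) - b))%R] <=
   (((lo * c) ^+ 2)^-1 *
     (p%:R * (2 * (B ^+ 2 * A + B ^+ 2 * K * (2 * k).+1%:R / T%:R))))%:E)%E.
Proof.
move=> T0 lo0 c0 hlo hX me me' eA eK cov0.
have TR : (0 : R) < T%:R by rewrite ltr0n.
have lc0 : 0 < (lo * c) ^+ 2 by rewrite exprn_gt0// mulr_gt0.
set S := [set w | _].
have mS : measurable S.
  by apply: measurable_set_ltr => //; exact: measurable_eucl_ols.
pose g (j : 'I_p) w := T%:R^-1 * \sum_(i < T) X i j * e (i.+1)%:Z w.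
have mg j : measurable_fun setT (g j).
  apply: measurable_funM => //; apply: measurable_sum => i; exact: measurable_funM.
pose D := 2 * (B ^+ 2 * A + B ^+ 2 * K * (2 * k).+1%:R / T%:R).
have gD j : (second_moment P (g j) <= D%:E)%E.
  pose g1 w := T%:R^-1 * \sum_(i < T) X i j * (e (i.+1)%:Z w - e' (i.+1)%:Z w).
  pose g2 w := T%:R^-1 * \sum_(i < T) X i j * e' (i.+1)%:Z w.
  have md (i : 'I_T) : measurable_fun setT (fun w => e (i.+1)%:Z w - e' (i.+1)%:Z w).
    exact: measurable_funB.
  have ms1 : measurable_fun setT
      (fun w => \sum_(i < T) X i j * (e (i.+1)%:Z w - e' (i.+1)%:Z w)).
    by apply: measurable_sum => i; exact: measurable_funM.
  have ms2 : measurable_fun setT (fun w => \sum_(i < T) X i j * e' (i.+1)%:Z w).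
    by apply: measurable_sum => i; exact: measurable_funM.
  rewrite (_ : g j = fun w => g1 w + g2 w); last first.
    apply/funext => w; rewrite /g /g1 /g2 -mulrDr -big_split/=; congr (_ * _).
    by apply: eq_bigr => i _; rewrite -mulrDr subrK.
  apply: second_moment_add_le.
  - exact: measurable_funM.
  - exact: measurable_funM.
  - rewrite second_momentZ//.
    apply: (@le_trans _ _ ((T%:R^-1 ^+ 2)%:E * (T%:R ^+ 2 * (B ^+ 2 * A))%:E)%E).
      rewrite lee_wpmul2l ?lee_fin ?sqr_ge0//.
      apply: second_moment_sum_le; first by move=> i; exact: measurable_funM.
      move=> i; rewrite second_momentZ// (EFinM (B ^+ 2)); apply: lee_pmul => //.
      + by rewrite lee_fin sqr_ge0.
      + exact: second_moment_ge0.
      + rewrite lee_fin -real_normK ?num_real// ler_pXn2r ?nnegrE//.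
        exact: le_trans (normr_ge0 _) (hX i j).
    rewrite -EFinM lee_fin le_eqVlt; apply/orP; left; apply/eqP.
    by move: (T%:R : R) TR => x x0; field; rewrite gt_eqF.
  - rewrite second_momentZ//.
    apply: (@le_trans _ _ ((T%:R^-1 ^+ 2)%:E * (B ^+ 2 * K * (T * (2 * k).+1)%:R)%:E)%E).
      rewrite lee_wpmul2l ?lee_fin ?sqr_ge0//.
      exact: second_moment_banded_sum_le.
    rewrite -EFinM lee_fin natrM le_eqVlt; apply/orP; left; apply/eqP.
    by move: (T%:R : R) TR ((2 * k).+1%:R : R) => x x0 y; field; rewrite gt_eqF.
have sumD : (\int[P]_w \sum_(j < p) (g j w ^+ 2)%:E <= (p%:R * D)%:E)%E.
  rewrite ge0_integral_sum//; last 2 first.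
  - by move=> j; exact: measurable_sqr_EFin.
  - by move=> j w _; rewrite lee_fin sqr_ge0.
  apply: (@le_trans _ _ (\sum_(j < p) D%:E)%E); first by apply: lee_sum => j _; exact: gD.
  by rewrite sumEFin lee_fin sumr_const card_ord mulr_natl.
rewrite mulrC EFinM lee_pdivlMr//.
apply: le_trans sumD.
(* Markov's inequality in integral form: [(lo c)^2] times the indicator of [S] is at most the sum of
   the [g j ^+ 2], pointwise. *)
rewrite -[S]setIT -integral_indic// muleC -ge0_integralZl_EFin//; last 2 first.
- exact/measurable_EFinP.
- exact: ltW.
apply: ge0_le_integral => //.
- by move=> w _; rewrite mule_ge0// lee_fin ltW.
- by apply: measurable_funeM; exact/measurable_EFinP.
- by apply: emeasurable_sum => j; exact: measurable_sqr_EFin.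
move=> w _; rewrite sumEFin -EFinM lee_fin indicE.
have [wS|wS] := boolP (w \in S); last by rewrite mulr0 sumr_ge0// => j _; exact: sqr_ge0.
rewrite mulr1; have := ols_error_le b (errvec e T w) T0 lo0 hlo.
rewrite (_ : \sum_j (T%:R^-1 * _) ^+ 2 = \sum_j g j w ^+ 2); last first.
  apply: eq_bigr => j _; congr ((_ * _) ^+ 2); apply: eq_bigr => i _.
  by rewrite mxE.
apply: le_trans; rewrite exprMn ler_wpM2l ?sqr_ge0// ler_pXn2r ?nnegrE ?(ltW c0) ?sqrtr_ge0//.
by move: wS; rewrite inE => /ltW.
Qed.

(** The first term is [p / (p^2 + 1) <= 1 / p]. For the second, [p >= 1] gives
    [p^2 (2 (p^2 + m) + 1) <= (2m + 3) p^4], and [p^4] is [O(x)]. *)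
Lemma truncation_rate_le {R : realType} (p m : nat) (x : R) : (0 < p)%N -> 0 < x ->
  p%:R ^+ 4 <= 8%:R ^+ 8 * x ->
  p%:R * ((p ^ 2).+1%:R^-1 + (2 * (p ^ 2 + m)).+1%:R / x)
    <= (1 + (2 * m + 3)%:R * 8%:R ^+ 8) * p%:R^-1.
Proof.
move=> p0 x0 h; have pR : (0 : R) < p%:R by rewrite ltr0n.
rewrite mulrDr mulrDl mul1r; apply: lerD.
  rewrite ler_pdivrMr ?ltr0n// mulrC ler_pdivlMr// -natrM ler_nat; lia.
rewrite mulrA ler_pdivrMr// mulrAC ler_pdivlMr//.
apply: (@le_trans _ _ ((2 * m + 3)%:R * p%:R ^+ 4)); last by rewrite -mulrA ler_wpM2l.
rewrite -natrX -!natrM ler_nat; nia.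
Qed.

Unset Implicit Arguments.

Theorem theorem3
  (R : realType) (dO : measure_display) (Omega : measurableType dO)
  (P : probability Omega R)
  (* dimensions of the model; the fixed response index nu *)
  (d q L m : nat) (nu : 'I_d)
  (* ingredients of the error model *)
  (phi : 'I_d -> 'I_L -> R) (r : 'I_L -> ('I_q -> R))
  (dist : ('I_q -> R) -> ('I_q -> R) -> R)
  (Cc : 'I_L.+1 -> nat -> 'M[R]_d)
  (eps u : 'I_L.+1 -> int -> 'I_d -> Omega -> R)
  (Sig Sroot : 'I_L.+1 -> int -> 'M[R]_d)
  (H : 'I_d -> 'M[R]_(d, m.+1) -> R)
  (s : int -> ('I_q -> R))
  (* regression design: p = p_T, regressors X_T, coefficients beta_nu *)
  (p : nat -> nat) (X : forall T : nat, 'M[R]_(T, p T))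
  (beta : forall T : nat, 'cV[R]_(p T)) :
  (* sites, locations and the function d *)
  (forall l i, 0 <= r l i <= 1) ->
  (forall t : int, (0 < t)%R -> forall i, 0 <= s t i <= 1) ->
  (forall x y : 'I_q -> R, (forall i, 0 <= x i <= 1) -> (forall i, 0 <= y i <= 1) ->
     0 <= dist x y <= 1) ->
  (* (E1) *)
  (forall l t k, measurable_fun setT (u l t k)) ->
  (forall l t k, P.-integrable setT (EFin \o u l t k)) ->
  (forall l t k, ('E_P[u l t k] = 0)%E) ->
  (forall l t, pos_def (Sig l t)) ->
  (forall l t, pos_def (Sroot l t) /\ Sroot l t *m Sroot l t = Sig l t) ->
  (forall l t k w, eps l t k w = \sum_(k' < d) Sroot l t k k' * u l t k' w) ->
  (forall l t k, ('E_P[eps l t k] = 0)%E) ->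
  (forall l t, indep_family P (fun k : 'I_d => sigma_gen (fun _ : unit => u l t k))) ->
  (forall l, indep_family P (fun t : int => sigma_gen (fun k : 'I_d => eps l t k))) ->
  indep_family P (fun l : 'I_L.+1 =>
     sigma_gen (fun tk : int * 'I_d => eps l tk.1 tk.2)) ->
  (* (E2) *)
  (exists (delta : R) (M : R), 0 < delta /\
     forall l t k, (\int[P]_w (`|eps l t k w| `^ (2 + delta))%:E <= M%:E)%E) ->
  (* (E3) *)
  (d = 1%N -> exists M : R, forall l t k, ('E_P[fun w => (eps l t k w ^+ 2)%R] <= M%:E)%E) ->
  (* (E4) *)
  (d = 1%N -> exists sigma0 : R, 0 < sigma0 /\
     forall t k, ((sigma0 ^+ 2)%:E <= 'E_P[fun w => (eps ord0 t k w ^+ 2)%R])%E) ->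
  ((1 < d)%N -> exists lam : R, 0 < lam /\
     forall t a, eigenvalue (Sig ord0 t) a -> lam <= a) ->
  (* (E5) *)
  (exists pdf : 'I_L.+1 -> int -> 'I_d -> R -> R,
     (forall l t k z, 0 <= pdf l t k z) /\
     (forall l t k, measurable_fun setT (pdf l t k)) /\
     (forall l t k (B : set R), measurable B ->
        P (eps l t k @^-1` B) = (\int[lebesgue_measure]_(z in B) (pdf l t k z)%:E)%E) /\
     (forall l k, exists C : R, forall t (x : R),
        (\int[lebesgue_measure]_z (`|pdf l t k (z + x) - pdf l t k z|)%:E
           <= (C * `|x|)%:E)%E)) ->
  (* (E6) *)
  (exists (C theta : R), 0 < theta /\
     forall l j k k', `|Cc l j k k'| <= C * ((maxn j 1)%:R `^ (- (7%:R / 2%:R) - theta))) ->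
  (* (E7) *)
  (exists LH : R, forall k (A B : 'M[R]_(d, m.+1)), `|H k A - H k B| <= LH * frob (A - B)) ->
  (exists (Xi : 'I_d -> 'I_m.+1 -> Omega -> R) (delta' : R),
     (forall i k, measurable_fun setT (Xi i k)) /\
     indep_family P (fun b : bool => if b
        then sigma_gen (fun ik : 'I_d * 'I_m.+1 => Xi ik.1 ik.2)
        else sigma_gen (fun tsk : int * unit_cube q * 'I_d =>
               Ufield phi dist r Cc eps (sval tsk.1.2) tsk.1.1 tsk.2)) /\
     0 < delta' /\
     forall k, (\int[P]_w (`|H k (\matrix_(i, j) Xi i j w)| `^ (2 + delta'))%:E < +oo)%E) ->
  (* (R) *)
  (exists B : R, forall T i j, `|X T i j| <= B) ->
  (exists (Sx : forall n : nat, 'M[R]_n) (eta C lo hi : R),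
     (forall n, pos_def (Sx n)) /\ 0 <= eta /\ 0 < lo /\ lo <= hi /\
     forall T : nat, (0 < T)%N ->
       \rank (X T) = p T /\
       opnorm2 ((T%:R)^-1 *: ((X T)^T *m X T) - Sx (p T))
         <= C * (p T)%:R `^ eta / Num.sqrt T%:R /\
       (forall a, eigenvalue ((T%:R)^-1 *: ((X T)^T *m X T)) a -> lo <= a <= hi)) ->
  (* boundedness |x_tj eps_t^{(nu')}| <= 1 *)
  (forall (T : nat) (i : 'I_T) (j : 'I_(p T)) (nu' : 'I_d),
     {ae P, forall w, `|X T i j * errproc P H phi dist r Cc eps s (i.+1)%:Z nu' w| <= 1}) ->
  (* T, p -> oo and the rate condition *)
  ((fun T => (p T)%:R : R) @ \oo --> +oo) ->
  (exists a : R, 0 < a < 1 /\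
     (fun T : nat => ln (p T)%:R * Num.sqrt (p T)%:R / (ln (T%:R : R)) `^ (1 - a))
       @ \oo --> (0 : R)) ->
  (* conclusion: consistency in probability *)
  forall e : R, 0 < e ->
    (fun T : nat => P [set w | e < eucl (ols (X T) (beta T)
          (errvec (fun t => errproc P H phi dist r Cc eps s t nu) T w) - beta T)])
      @ \oo --> 0%E.
Proof.
move=> hr hs hdist mu _ _ _ _ epsE _ _ indt indl [delta [M [delta0 hM]]] _ _ _ _.
move=> [C [theta [theta0 hC]]] [LH lipH] _ [B hB].
move=> [Sx [eta [CR [lo [hi [_ [_ [lo0 [_ hR]]]]]]]]] _ pT [a [a01 rate]] c c0.
have meps l t k : measurable_fun setT (eps l t k).
  rewrite (_ : eps l t k = fun w => \sum_(k' < d) Sroot l t k k' * u l t k' w).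
    by apply: measurable_sum => k'; exact: measurable_funM.
  by apply/funext => w; exact: epsE.
have eps2 l t k : (second_moment P (eps l t k) <= (1 + M)%:E)%E.
  exact: second_moment_le_of_powR delta0 (meps l t k) (hM l t k).
have Cc6 l j k k' : `|Cc l j k k'| <= `|C| * 6%:R * (j.+1 * j.+2)%:R^-1.
  rewrite (le_trans (hC l j k k'))// -mulrA.
  apply: le_trans (ler_wpM2l (normr_ge0 C) (polynomial_decay_le j theta0)).
  by rewrite ler_wpM2r ?powR_ge0// ler_norm.
(* As [dist] takes values in [[0, 1]] on the cube, the sum of all [|phi k l|] bounds every loading,
   uniformly in [t]. *)
pose F := \sum_k \sum_l `|phi k l|.
have phiF (t : int) : 0 < t -> forall k l, `|phi k l * dist (s t) (r l)| <= F.
  move=> t0 k l; have /andP[d0 d1] := hdist _ _ (hs t t0) (hr l).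
  rewrite normrM (ger0_norm d0) (le_trans (ler_piMr _ d1))//.
  rewrite /F (bigD1 k)//= (bigD1 l)//= -addrA lerDl addr_ge0 ?sumr_ge0// => i _.
  exact: sumr_ge0.
have [K K0 hK] := errproc_truncation nu meps eps2 Cc6 phiF lipH.
(* The factors are the Markov constant, the [2 B^2 K] common to the remainder [K / (n+1)] and to the
   band term, and the constant of [truncation_rate_le]. *)
pose Kc := ((lo * c) ^+ 2)^-1 * (2 * (B ^+ 2 * K)) * (1 + (2 * m + 3)%:R * 8%:R ^+ 8).
have bound : \forall T \near \oo,
    (0 <= P [set w | (c < eucl (ols (X T) (beta T)
      (errvec (fun t => errproc P H phi dist r Cc eps s t nu) T w) - beta T))%R]
      <= (Kc * (p T)%:R^-1)%:E)%E.
  have p1 : \forall T \near \oo, 1 <= (p T)%:R :> R by move/cvgryPge : pT; exact.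
  have p4 := eventually_pow4_le a01 pT rate.
  near=> T.
  have T0 : (0 < T)%N by near: T; exact: nbhs_infty_gt.
  have p0 : (0 < p T)%N by rewrite -(ltr_nat R) (lt_le_trans ltr01)//; near: T.
  have [_ [_ hlo]] := hR T T0.
  pose n := (p T ^ 2)%N.
  apply/andP; split => //.
  apply: (le_trans (@probability_ols_error_le _ _ _ P T (p T) (X T) (beta T)
    (fun t => errproc P H phi dist r Cc eps s t nu)
    (fun t => errproc P H phi dist r (ctrunc n Cc) eps s t nu)
    (n + m) B (K / n.+1%:R) K lo c T0 lo0 c0 _ (hB T) _ _ _ _ _)).
  - by move=> b /hlo/andP[].
  - by move=> i; case: (hK n i.+1%:Z).
  - by move=> i; case: (hK n i.+1%:Z).
  - by move=> i; case: (hK n i.+1%:Z).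
  - by move=> i; case: (hK n i.+1%:Z).
  - move=> i j ij.
    have [//|_ _ _ hi1 hi0] := hK n i.+1%:Z; have [//|_ _ _ hj1 _] := hK n j.+1%:Z.
    apply: (errproc_ctrunc_uncorrelated meps indt indl lipH _ hi1 hj1 hi0).
    by move: ij; lia.
  set z := (p T)%:R * ((n.+1%:R : R)^-1 + (2 * (n + m)).+1%:R / T%:R).
  have zle : z <= (1 + (2 * m + 3)%:R * 8%:R ^+ 8) * (p T)%:R^-1.
    by apply: truncation_rate_le; rewrite ?ltr0n//; near: T.
  rewrite lee_fin (_ : _ * (_ * _) = ((lo * c) ^+ 2)^-1 * (2 * (B ^+ 2 * K)) * z); last first.
    by rewrite /z; ring.
  rewrite /Kc -[leRHS]mulrA ler_wpM2l//.
  by rewrite mulr_ge0 ?invr_ge0 ?sqr_ge0// mulr_ge0// mulr_ge0// sqr_ge0.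
apply: (squeeze_cvge bound); first exact: cvg_cst.
apply: cvg_EFin; first exact: nearW.
rewrite -[X in _ --> X](mulr0 Kc); apply: cvgMr.
apply/gtr0_cvgV0 => //.
have := pT => /cvgryPge/(_ 1); apply: filterS => T; exact: lt_le_trans.
Unshelve. all: by end_near.
Qed.
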